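(* Let $k\ge 1$ be an integer and suppose that conditions $\mathcal L_1$, $\mathcal L_2$, $\mathcal L_3$ listed in the context hold for this $k$. Then for every true value $\vartheta_0\in\Theta$ and every $n\ge 1$ there exist random variables $r_n=r_{n,k}$, $\phi_n=\phi_{n,k}$ and a measurable set (event) $\mathbb B=\mathbb B_{n,k}(\vartheta_0)$ such that the method of moments estimator $\check\vartheta_n$ admits the representation $$\check\vartheta_n=\vartheta_0+\left\{\sum_{l=1}^{k}\psi_l(\vartheta_0)\,\eta_n^{\,l}\,n^{-l/2}+r_n\,n^{-\frac k2-\frac14}\right\}\mathbf 1_{\mathbb B}+\phi_n\,\mathbf 1_{\mathbb B^c},$$ where $\eta_n=\eta_n(\vartheta_0)$, $|r_n|\le 1$, $\phi_n\in[\alpha-\vartheta_0,\beta-\vartheta_0]$, and such that for every $Q>0$ and every compact set $\mathbb K\subset\Theta$ there exists a constant $C=C(Q,\mathbb K)>0$, not depending on $n$, with $$\sup_{\vartheta_0\in\mathbb K}\mathbf P_{\vartheta_0}(\mathbb B^c)\le \frac{C}{n^{Q}}\qquad\text{for all } n\ge 1.$$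
   Context: Let $\Theta=(\alpha,\beta)$ be a bounded open interval of $\mathbb R$ and let $\mathcal T\subset\mathbb R$ be an interval (bounded or not). For each $\vartheta\in\Theta$ let $\lambda(\vartheta,\cdot):\mathcal T\to[0,\infty)$ be an intensity function. One observes $n$ independent inhomogeneous Poisson (counting) processes $X^{(n)}=(X_1,\dots,X_n)$, $X_j=\{X_j(t),\,t\in\mathcal T\}$, all with the same intensity function $\lambda(\vartheta_0,\cdot)$, where $\vartheta_0\in\Theta$ is the true value; $\mathbf P_{\vartheta_0}$ and $\mathbf E_{\vartheta_0}$ denote the corresponding probability and expectation. Let $g:\mathcal T\to\mathbb R$ be a given measurable function and put $$m(\vartheta)=\int_{\mathcal T}g(t)\lambda(\vartheta,t)\,dt,\qquad \bar m_n=\frac1n\sum_{j=1}^n\int_{\mathcal T}g(t)\,dX_j(t).$$ Conditions $\mathcal L$ (for a given integer $k\ge1$): $\mathcal L_1$: the function $m(\vartheta)$, $\vartheta\in\Theta$, has $k+2$ continuous bounded derivatives. $\mathcal L_2$: the function $m(\vartheta)$, $\vartheta\in\Theta$, is monotone and $\inf_{\vartheta\in\Theta}|\dot m(\vartheta)|>0$, where $\dot m$ is the derivative of $m$ with respect to $\vartheta$. $\mathcal L_3$: for every $q>0$, $\ \sup_{\vartheta\in\Theta}\int_{\mathcal T}|g(t)|^{q}\lambda(\vartheta,t)\,dt<\infty$. Under these conditions $m$ is regarded as a continuous function on $[\alpha,\beta]$ (extended by its limits at the endpoints), and $G$ denotes the inverse function of $m$, so that $G(m(\vartheta))=\vartheta$;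 $G^{(l)}$ is its $l$-th derivative. The method of moments estimator (MME) $\check\vartheta_n$ is the value of $\vartheta\in[\alpha,\beta]$ minimizing $(m(\vartheta)-\bar m_n)^2$. Thus, when $m$ is increasing, $\check\vartheta_n=\alpha$ if $\bar m_n\le m(\alpha)$, $\check\vartheta_n=G(\bar m_n)$ if $m(\alpha)<\bar m_n<m(\beta)$, and $\check\vartheta_n=\beta$ if $\bar m_n\ge m(\beta)$. Notation: $\psi_l(\vartheta_0)=\dfrac{G^{(l)}(m(\vartheta_0))}{l!}$ for $l=1,\dots,k$, and $$\eta_n(\vartheta_0)=\sqrt n\,(\bar m_n-m(\vartheta_0))=\frac1{\sqrt n}\int_{\mathcal T}g(t)\,d\pi_n(t),\qquad d\pi_n(t)=\sum_{j=1}^n dX_j(t)-n\lambda(\vartheta_0,t)\,dt.$$ $\mathbf 1_{A}$ is the indicator of the event $A$, and $\mathbb B^c$ is the complement of $\mathbb B$. *)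

(* Defs.v *)
(* MathComp / MathComp-Analysis *)
From HB Require Import structures.
From mathcomp Require Import all_boot all_order all_algebra.
From mathcomp Require Import all_classical all_reals all_analysis.

Set Implicit Arguments.
Unset Strict Implicit.
Unset Printing Implicit Defensive.

Import Order.TTheory GRing.Theory Num.Theory.
Import numFieldNormedType.Exports.

Local Open Scope classical_set_scope.
Local Open Scope ring_scope.

Section counting_paths.
Context {R : realType}.
Implicit Types (T : set R) (x : R -> R).

(* Only increments are required to be integers: on an interval unbounded to the
   left a counting process is normalised at an interior point and takes negative
   values before it. At a right end point of T belonging to T the filter
   [within T t^'+] is trivial, so nothing is required there. *)
Definition counting_path T x :=
  (forall s t, T s -> T t -> s <= t -> x t - x s \is a Num.nat) /\
  (forall t, T t -> x s @[s --> within T t^'+] --> x t).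

(* Number of events at time t; a left end point of T carries no event, since a
   counting process starts from a fixed value there. The absolute value only
   serves to make [path_measure] a measure for arbitrary x. *)
Definition jump T x (t : R) : R :=
  if `[< exists2 s, T s & s < t >] then `|x t - lim (x s @[s --> t^'-])| else 0.

Lemma jump_ge0 T x t : 0 <= jump T x t.
Proof. by rewrite /jump; case: ifP. Qed.

(* The measure dX on T of a path X: the sum of the unit masses at its events,
   so that the integral of g against it is the sum of g over the events. *)
Definition path_measure T x (A : set (measurableTypeR R)) : \bar R :=
  \esum_(t in A `&` T) (jump T x t)%:E.

Let path_measure0 T x : path_measure T x set0 = 0%E.
Proof. by rewrite /path_measure set0I esum_set0. Qed.

Let path_measure_ge0 T x A : (0 <= path_measure T x A)%E.
Proof. by apply: esum_ge0 => t _; rewrite lee_fin jump_ge0. Qed.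

Let path_measure_sigma_additive T x : semi_sigma_additive (path_measure T x).
Proof.
move=> F mF tF mUF; rewrite /path_measure setI_bigcupl esum_bigcupT.
- rewrite -nneseries_esumT; last by move=> i; apply: path_measure_ge0.
  by apply: is_cvg_nneseries => i _ _; apply: path_measure_ge0.
- exact: trivIset_setIr.
- by move=> t; rewrite lee_fin jump_ge0.
Qed.

HB.instance Definition _ T x := isMeasure.Build _ _ _ (path_measure T x)
  (path_measure0 T x) (path_measure_ge0 T x)
  (@path_measure_sigma_additive T x).

End counting_paths.

Section poisson_processes.
Context {R : realType}.

Definition intensity_function (T : set R) (l : R -> R) :=
  [/\ forall t, T t -> 0 <= l t,
      measurable_fun T l &
      forall s t, T s -> T t ->
        lebesgue_measure.-integrable `[s, t] (EFin \o l)].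

Context (d : measure_display) (Omega : measurableType d).
Implicit Types (P : probability Omega R) (T : set R).

Definition mutually_independent P (I : finType)
    (F : I -> set (set Omega)) :=
  forall (J : {set I}) (E : I -> set Omega), (forall i, i \in J -> F i (E i)) ->
    fine (P (\bigcap_(i in [set` J]) E i)) = \prod_(i in J) fine (P (E i)).

Definition sigma_process T (X : R -> Omega -> R) : set (set Omega) :=
  <<s \bigcup_(t in T) preimage_set_system setT (X t) measurable >>.

(* The second argument of [poisson_prob] is not used by the library;
   [poisson_pmf] is not used because it is 1 at rate 0 for every k. *)
Definition poisson_process P T (l : R -> R) (X : R -> Omega -> R) :=
  [/\ forall w, counting_path T (X ^~ w),
      forall (p : nat) (t : nat -> R),
        (forall i, (i <= p)%N -> T (t i)) ->
        (forall i, (i < p)%N -> t i < t i.+1) ->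
        mutually_independent P (fun i : 'I_p =>
          preimage_set_system setT (fun w => X (t i.+1) w - X (t i) w)
            measurable) &
      forall s t, T s -> T t -> s < t -> forall c : nat,
        P [set w | X t w - X s w = c%:R] =
        poisson_prob (\int[lebesgue_measure]_(u in `]s, t]) l u) 0 [set c]].

Definition poisson_sample P T (l : R -> R) (n : nat)
    (X : 'I_n -> R -> Omega -> R) :=
  (forall j, poisson_process P T l (X j)) /\
  mutually_independent P (fun j => sigma_process T (X j)).

(* Where g is not integrable against some dX_j (a null event when g is
   integrable against the intensity) the value is unspecified. *)
Definition empirical_moment T (g : R -> R) (n : nat)
    (X : 'I_n -> R -> Omega -> R) (w : Omega) : R :=
  n%:R^-1 * \sum_(j < n) \int[path_measure T (X j ^~ w)]_(t in T) g t.

End poisson_processes.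

Section method_of_moments.
Context {R : realType}.
Implicit Types (alpha beta : R) (m : R -> R).

Definition moment (T : set R) (g : R -> R) (lam : R -> R -> R) (th : R) : R :=
  \int[lebesgue_measure]_(t in T) (g t * lam th t).

Definition condition_L1 alpha beta (k : nat) m :=
  (forall i, (i < k.+2)%N ->
     {in `]alpha, beta[, forall th : R, derivable (derive1n i m) th 1}) /\
  (forall i, (1 <= i <= k.+2)%N ->
     {in `]alpha, beta[, continuous (derive1n i m)} /\
     [bounded derive1n i m th | th in `]alpha, beta[%classic]).

Definition condition_L2 alpha beta m :=
  ({in `]alpha, beta[ &, {homo m : x y / x <= y}} \/
   {in `]alpha, beta[ &, {homo m : x y /~ x <= y}}) /\
  0 < inf [set `|derive1 m th| | th in `]alpha, beta[%classic].

Definition condition_L3 alpha beta (T : set R) (g : R -> R)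
    (lam : R -> R -> R) :=
  forall q : R, 0 < q ->
    (ereal_sup [set \int[lebesgue_measure]_(t in T)
                      (`|g t| `^ q * lam th t)%:E
               | th in `]alpha, beta[%classic] < +oo)%E.

Definition extend alpha beta m (th : R) : R :=
  if th <= alpha then lim (m x @[x --> alpha^'+])
  else if beta <= th then lim (m x @[x --> beta^'-])
  else m th.

Definition is_mme alpha beta m (y : R) (th : R) :=
  th \in `[alpha, beta] /\
  {in `[alpha, beta], forall th' : R,
     (extend alpha beta m th - y) ^+ 2 <= (extend alpha beta m th' - y) ^+ 2}.

Definition mme alpha beta m (y : R) : R := xget alpha (is_mme alpha beta m y).

Definition inverse_moment alpha beta m : R -> R :=
  'pinv_(fun=> alpha) `[alpha, beta]%classic (extend alpha beta m).

Definition psi alpha beta m (l : nat) (th : R) : R :=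
  derive1n l (inverse_moment alpha beta m) (m th) / l`!%:R.

End method_of_moments.

(* Main.v *)
Require Import Defs.
From HB Require Import structures.
From mathcomp Require Import all_boot all_order all_algebra.
From mathcomp Require Import all_classical all_reals all_analysis.
From mathcomp Require Import measurable_realfun ring lra zify.
Import Order.TTheory GRing.Theory Num.Theory.
Import numFieldNormedType.Exports.

Local Open Scope classical_set_scope.
Local Open Scope ring_scope.

Set Implicit Arguments.
Unset Strict Implicit.
Unset Printing Implicit Defensive.

(** The estimator is a fixed function of the empirical moment mbar: on the open
    interval m(Theta) it is the inverse G of m. There the expansion is Taylor's
    formula for G at m(th0), written with eta = sqrt n (mbar - m(th0)).
    Differentiating G' = 1 / m'(G) shows that each derivative of G up to order
    k+1 is a bounded function of G, because m' is bounded away from 0 and the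
    higher derivatives of m are bounded. Hence the remainder is at most
    C0 |mbar - m(th0)|^(k+1), with C0 independent of th0 (mme_expansion).

    The event B asks that mbar lie in m(Theta) and that |eta| <= c0 n^gamma with
    gamma = 1 / (4 (k+1)). This exponent is the one for which C0 times
    (c0 n^gamma / sqrt n)^(k+1) becomes n^(-k/2 - 1/4). So r is the rescaled
    remainder on B and 0 elsewhere, and phi is the error of the estimator; both
    are measurable since the estimator is monotone in mbar. For th0 in a compact
    K, a ball about m(th0) of radius independent of th0 stays inside m(Theta), so
    the complement of B forces |eta| >= c n^gamma, and it suffices to bound
    P(|eta| >= y) uniformly in th0 (empirical_moment_tail).

    The function g is neither regular nor bounded, and only the laws of the
    increments X(t) - X(s) are given. So g is replaced by a step function u with
    |u| <= sqrt n which is close to g in L1(lambda dt) (clipped_step_approx).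
    - The sum over the sample of the integrals of u is a finite combination of
      independent Poisson increments. Its exponential moments are explicit
      (mgf_sample), and the Chernoff bound with exponent 1 / (2 sqrt n) gives
      exp(const - y/4); the constant depends on the second moment of g only.
    - The error is controlled by Markov's inequality and Campbell's formula
      E int |g - u| dX = int |g - u| lambda dt (campbell). Clipping at sqrt n costs
      at most n^(-M) times the moment of g of order 2M+1, for any M.

    Campbell's formula comes from an identity between measures which has to be
    checked on intervals only. There it says that E(X(t) - X(s)) is the integral
    of lambda over ]s, t], once one knows that the jumps of a counting path in
    ]s, t] add up to its increment (path_measure_itv). *)

(** * Taylor expansion of the estimator as a function of the empirical moment *)

Section bounded_derivatives.
Context {R : realType} (a b : R).
Implicit Types (f g : R -> R) (j : nat).

(** The derivative is existentially quantified rather than computed by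
    [derive1], so that closure under products and inverses needs no
    differentiability side conditions. *)
Fixpoint bdiff j f : Prop :=
  (exists M : R, {in `]a, b[, forall x, `|f x| <= M}) /\
  if j is j'.+1 then exists f' : R -> R,
    {in `]a, b[, forall x : R, is_derive x 1 f (f' x)} /\ bdiff j' f' else True.

Lemma bdiff_bounded j f : bdiff j f ->
  exists M : R, {in `]a, b[, forall x, `|f x| <= M}.
Proof. by case: j => [|j] []. Qed.

Lemma bdiffW j f : bdiff j.+1 f -> bdiff j f.
Proof.
elim: j f => [|j IH] f [bf [f' [df bf']]]; first by split.
by split => //; exists f'; split => //; exact: IH.
Qed.

Lemma bdiffD j f g : bdiff j f -> bdiff j g -> bdiff j (fun x => f x + g x).
Proof.
elim: j f g => [|j IH] f g [[M fM] bf] [[N gN] bg]; split.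
- by exists (M + N) => x xab; rewrite (le_trans (ler_normD _ _))// lerD ?fM ?gN.
- by [].
- by exists (M + N) => x xab; rewrite (le_trans (ler_normD _ _))// lerD ?fM ?gN.
- case: bf bg => f' [df bf'] [g' [dg bg']].
  exists (fun x => f' x + g' x); split; last exact: IH.
  by move=> x xab; apply: is_deriveD; [exact: df|exact: dg].
Qed.

Lemma bdiffM j f g : bdiff j f -> bdiff j g -> bdiff j (fun x => f x * g x).
Proof.
elim: j f g => [|j IH] f g bf0 bg0; move: (bf0) (bg0) => [[M fM] bf] [[N gN] bg].
  split=> //; exists (M * N) => x xab; rewrite normrM ler_pM// ?fM ?gN//.
split.
  by exists (M * N) => x xab; rewrite normrM ler_pM// ?fM ?gN.
case: bf bg => f' [df bf'] [g' [dg bg']].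
exists (fun x => f x * g' x + g x * f' x); split; last first.
  by apply: bdiffD; apply: IH => //; exact: bdiffW.
by move=> x xab; apply: is_deriveM; [exact: df|exact: dg].
Qed.

Lemma bdiff_opp j f : bdiff j f -> bdiff j (fun x => - f x).
Proof.
elim: j f => [|j IH] f [[M fM] bf]; split.
- by exists M => x xab; rewrite normrN fM.
- by [].
- by exists M => x xab; rewrite normrN fM.
- case: bf => f' [df bf']; exists (fun x => - f' x); split; last exact: IH.
  by move=> x xab; apply: is_deriveN; exact: df.
Qed.

Lemma bdiffV j f (c : R) : 0 < c -> {in `]a, b[, forall x, c <= `|f x|} ->
  bdiff j f -> bdiff j (fun x => (f x)^-1).
Proof.
move=> c0 fc; elim: j f fc => [|j IH] f fc bf0; move: (bf0) => [_ bf].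
  split=> //; exists c^-1 => x xab.
  by rewrite normfV lef_pV2 ?posrE// ?(lt_le_trans c0)// fc.
split.
  exists c^-1 => x xab.
  by rewrite normfV lef_pV2 ?posrE// ?(lt_le_trans c0)// fc.
case: bf => f' [df bf'].
have bV : bdiff j (fun x => (f x)^-1) by apply: IH => //; exact: bdiffW.
exists (fun x => - ((f x)^-1 * (f x)^-1 * f' x)); split; last first.
  by apply: bdiff_opp; apply: bdiffM => //; exact: bdiffM.
move=> x xab; have fx0 : f x != 0 by rewrite -normr_gt0 (lt_le_trans c0)// fc.
have -> : - ((f x)^-1 * (f x)^-1 * f' x) = - (f x) ^- 2 *: f' x.
  by rewrite -[_ *: _]/(_ * _) mulNr -exprVn expr2.
by apply: is_deriveV => //; exact: df.
Qed.

End bounded_derivatives.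

Section taylor.
Context {R : realType}.

Lemma is_derive_congr (f g : R -> R) (x d e : R) :
  is_derive x 1 f d -> f =1 g -> d = e -> is_derive x 1 g e.
Proof. by move=> + /funext <- <-. Qed.

(** Differentiating z |-> sum_i f_i(z) (y - z)^i / i! telescopes to the single
    term f_(k+1)(z) (y - z)^k / k!, so the mean value inequality applies. *)
Lemma taylor_bound (f : nat -> R -> R) (k : nat) (M y0 y : R) :
  {in `[Num.min y0 y, Num.max y0 y], forall z : R,
    (forall i, (i <= k)%N -> is_derive z 1 (f i) (f i.+1 z)) /\
    `|f k.+1 z| <= M} ->
  `|f 0%N y - \sum_(i < k.+1) f i y0 / i`!%:R * (y - y0) ^+ i|
    <= M * `|y - y0| ^+ k.+1.
Proof.
move=> H.
pose F k z := \sum_(i < k.+1) f i z / i`!%:R * (y - z) ^+ i.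
have dF z : z \in `[Num.min y0 y, Num.max y0 y] -> forall j, (j <= k)%N ->
    is_derive z 1 (F j) (f j.+1 z / j`!%:R * (y - z) ^+ j).
  move=> zI; elim => [_|j IH jk].
    have -> : F 0%N = f 0%N.
      by apply/funext => w; rewrite /F big_ord1 fact0 divr1 expr0 mulr1.
    rewrite fact0 divr1 expr0 mulr1; exact: (H z zI).1.
  have -> : F j.+1 = F j + (fun w => f j.+1 w * ((j.+1)`!%:R^-1 * (y - w) ^+ j.+1)).
    by apply/funext => w; rewrite /F big_ord_recr/= fctE/= mulrA.
  have dX : is_derive z 1 (fun w : R => (j.+1)`!%:R^-1 * (y - w) ^+ j.+1)
      (- ((j`!)%:R^-1 * (y - z) ^+ j)).
    have D := is_deriveZ ((j.+1)`!%:R^-1 : R) (is_deriveX j.+1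
      (is_deriveB (is_derive_cst y z 1) (is_derive_id z 1))).
    apply: (is_derive_congr D); first by move=> w; rewrite fctE.
    rewrite factS natrM invfM /cst/= /GRing.scale/= sub0r.
    have j0 : (j.+1)%:R != 0 :> R by rewrite pnatr_eq0.
    have jf0 : (j`!)%:R != 0 :> R by rewrite pnatr_eq0 -lt0n fact_gt0.
    rewrite -[(cst y - id) z]/(y - z); field.
    by apply/andP; split.
  have d1 := (H z zI).1 _ jk.
  have := is_deriveD (IH (ltnW jk)) (is_deriveM d1 dX) => D.
  apply: (is_derive_congr D) => //; rewrite /GRing.scale/=; ring.
have Fy : F k y = f 0%N y.
  rewrite /F big_ord_recl/= fact0 divr1 expr0 mulr1 big1 ?addr0// => i _.
  by rewrite subrr expr0n mulr0.
rewrite -Fy -/(F k y0).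
have M0 : 0 <= M.
  have /H[_] : y \in `[Num.min y0 y, Num.max y0 y].
    by rewrite in_itv/= ge_min lexx orbT le_max lexx orbT.
  exact: le_trans.
have bnd z : z \in `[Num.min y0 y, Num.max y0 y] ->
    `|f k.+1 z / k`!%:R * (y - z) ^+ k| <= M * `|y - y0| ^+ k.
  move=> zI; rewrite normrM ler_pM//.
    rewrite normrM -[leRHS]mulr1 ler_pM//; first exact: (H z zI).2.
    rewrite normfV normr_nat invf_le1 ?ltr0n ?fact_gt0// ler1n fact_gt0//.
  rewrite normrX lerXn2r ?nnegrE//.
  move: zI; rewrite in_itv/= ge_min le_max => /andP[/orP[] h1 /orP[] h2];
  by do 2 case: ler0P => ?; lra.
have cont : {within `[Num.min y0 y, Num.max y0 y], continuous (F k)}.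
  apply: derivable_within_continuous => z zI.
  by case: (dF z zI k (leqnn _)).
have [y0y|/ltW yy0] := leP y0 y.
  rewrite (min_idPl y0y) (max_idPr y0y) in dF cont bnd.
  have [z zI ->] := MVT_segment y0y
    (fun z h => dF z (subset_itv_oo_cc h) k (leqnn _)) cont.
  by rewrite exprSr mulrA normrM ler_wpM2r// bnd.
rewrite (min_idPr yy0) (max_idPl yy0) in dF cont bnd.
have [z zI] := MVT_segment yy0
    (fun z h => dF z (subset_itv_oo_cc h) k (leqnn _)) cont.
rewrite distrC => ->.
by rewrite exprSr mulrA normrM (distrC y0 y) ler_wpM2r// bnd.
Qed.

End taylor.

Section inverse_moment_theory.
Context {R : realType} (a b : R).
Implicit Types (m : R -> R).

Lemma L1_bdiff k m : condition_L1 a b k m -> bdiff a b k.+1 (derive1 m).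
Proof.
move=> [dm bm].
have bnd i : (1 <= i <= k.+2)%N ->
    exists M : R, {in `]a, b[, forall x, `|derive1n i m x| <= M}.
  move=> /bm[_ /pinfty_ex_gt0[M M0 bM]].
  by exists M => x xab; apply: bM; rewrite inE in xab *.
suff H j i : (i + j = k.+1)%N -> bdiff a b j (derive1n i.+1 m) by exact: (H k.+1 0%N).
elim: j i => [|j IH] i ijk.
  by split => //; apply: bnd; lia.
split; first by apply: bnd; lia.
exists (derive1n i.+2 m); split; last by apply: IH; lia.
move=> x xab; apply: DeriveDef; first by apply: dm => //; lia.
by rewrite -derive1E.
Qed.

Lemma L1_is_derive k m : condition_L1 a b k m ->
  {in `]a, b[, forall x : R, is_derive x 1 m (derive1 m x)}.
Proof.
move=> [dm _] x xab; apply: DeriveDef; first exact: (dm 0%N).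
by rewrite derive1E.
Qed.

Lemma L2_inf m : condition_L2 a b m ->
  exists2 c : R, 0 < c & {in `]a, b[, forall x, c <= `|derive1 m x|}.
Proof.
move=> [_ c0]; eexists; first exact: c0.
move=> x xab; apply: ge_inf; last by exists x => //; rewrite inE in xab.
by exists 0 => _ [t _ <-].
Qed.

Context (m : R -> R).
Hypothesis dm : {in `]a, b[, forall x : R, is_derive x 1 m (derive1 m x)}.

Lemma within_continuous_subitv (x y : R) : x \in `]a, b[ -> y \in `]a, b[ ->
  {within `[x, y], continuous m}.
Proof.
move=> xab yab; apply: derivable_within_continuous => z zxy.
have /dm[] // : z \in `]a, b[.
move: xab yab zxy; rewrite !in_itv/= => /andP[ax xb] /andP[ay yb] /andP[xz zy].
by rewrite (lt_le_trans ax)// (le_lt_trans zy).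
Qed.

Lemma mean_value_in (x y : R) : x \in `]a, b[ -> y \in `]a, b[ -> x <= y ->
  exists2 z, z \in `]a, b[ & m y - m x = derive1 m z * (y - x).
Proof.
move=> xab yab xy.
have sub z : z \in `[x, y] -> z \in `]a, b[.
  move: xab yab; rewrite !in_itv/= => /andP[ax xb] /andP[ay yb] /andP[xz zy].
  by rewrite (lt_le_trans ax)// (le_lt_trans zy).
have [z zxy ->] := MVT_segment xy
  (fun z h => dm (sub _ (subset_itv_oo_cc h))) (within_continuous_subitv xab yab).
by exists z => //; exact: sub.
Qed.

(** The sign s is 1 when m increases and -1 when it decreases, so that the rest
    of the argument need not distinguish the two cases. *)
Lemma L2_expanding (c : R) : {in `]a, b[, forall x, c <= `|derive1 m x|} ->
  condition_L2 a b m -> exists2 s : R, s = 1 \/ s = -1 &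
  {in `]a, b[ &, forall x y, c * (x - y) ^+ 2 <= s * (m x - m y) * (x - y)}.
Proof.
move=> cm [mono _].
have mvt x y : x \in `]a, b[ -> y \in `]a, b[ -> x <= y ->
    c * (y - x) <= `|m y - m x|.
  move=> xab yab xy; have [z zab ->] := mean_value_in xab yab xy.
  by rewrite normrM (ger0_norm (x := y - x)) ?subr_ge0// ler_wpM2r ?subr_ge0// cm.
case: mono => mono.
- exists 1; first by left.
  move=> x y xab yab; rewrite mul1r.
  have [xy|/ltW yx] := leP x y.
    have := mvt _ _ xab yab xy; rewrite ger0_norm ?subr_ge0 ?mono//; nra.
  have := mvt _ _ yab xab yx; rewrite ger0_norm ?subr_ge0 ?mono//; nra.
- exists (-1); first by right.
  move=> x y xab yab.
  have [xy|/ltW yx] := leP x y.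
    have := mvt _ _ xab yab xy; rewrite ler0_norm ?subr_le0 ?mono//; nra.
  have := mvt _ _ yab xab yx; rewrite ler0_norm ?subr_le0 ?mono//; nra.
Qed.

End inverse_moment_theory.

Section extended_moment.
Context {R : realType} (a b : R) (m : R -> R) (c M s : R).
Hypothesis ab : a < b.
Hypothesis c0 : 0 < c.
Hypothesis dm : {in `]a, b[, forall x : R, is_derive x 1 m (derive1 m x)}.
Hypothesis mM : {in `]a, b[, forall x, `|derive1 m x| <= M}.
Hypothesis s1 : s = 1 \/ s = -1.
Hypothesis expm :
  {in `]a, b[ &, forall x y, c * (x - y) ^+ 2 <= s * (m x - m y) * (x - y)}.

Local Notation e := (extend a b m).

Lemma lipschitz_in : {in `]a, b[ &, forall x y, `|m x - m y| <= M * `|x - y|}.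
Proof.
have mvt x y : x \in `]a, b[ -> y \in `]a, b[ -> x <= y ->
    `|m y - m x| <= M * `|y - x|.
  move=> xab yab xy; have [z zab ->] := mean_value_in dm xab yab xy.
  by rewrite normrM ler_wpM2r// mM.
move=> x y xab yab; have [/(mvt _ _ xab yab)|/ltW/(mvt _ _ yab xab)//] := leP x y.
by rewrite distrC (distrC y).
Qed.

(** m is Lipschitz, hence maps a convergent filter to a Cauchy one. *)
Lemma is_cvg_interior_filter (F : set_system R) (p : R) : ProperFilter F ->
  F `]a, b[%classic -> F --> p -> cvg (m x @[x --> F]).
Proof.
move=> PF Fab Fp; apply/cauchy_cvgP; apply: cauchy_exP => eps eps0.
have M1 : 0 < `|M| + 1 by rewrite ltr_pwDr.
pose h := eps / (2 * (`|M| + 1)).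
have h0 : 0 < h by rewrite divr_gt0// mulr_gt0.
have Fh : F (ball p h) by apply: Fp; exact: nbhsx_ballx.
have [x0 [x0ab x0h]] : `]a, b[%classic `&` ball p h !=set0.
  by apply: (@filter_ex _ F); exact: filterI.
exists (m x0).
suff : F [set x | ball (m x0) eps (m x)] by [].
apply: filterS (filterI Fab Fh) => x [xab xh].
rewrite /= -ball_normE /ball_/=.
move: xh x0h; rewrite -ball_normE /ball_/= => xh x0h.
rewrite (le_lt_trans (lipschitz_in _ _))//.
have d : `|x0 - x| < 2 * h.
  have := ler_distD p x0 x; rewrite (distrC x0 p); lra.
have -> : eps = (`|M| + 1) * (2 * h).
  by rewrite /h; field; rewrite gt_eqF.
rewrite (@le_lt_trans _ _ ((`|M| + 1) * `|x0 - x|))//.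
  by rewrite ler_wpM2r// (le_trans (ler_norm _))// lerDl.
by rewrite ltr_pM2l.
Qed.

Lemma extendE : {in `]a, b[, e =1 m}.
Proof. by move=> x; rewrite in_itv/= /extend => /andP[ax xb]; rewrite leNgt ax/= leNgt xb. Qed.

(** Transfers closed inequalities from the open interval to its closure
    without separating interior points from the two end points. *)
Lemma extend_filter (x : R) : x \in `[a, b] ->
  exists2 F : set_system R, ProperFilter F &
    [/\ F `]a, b[%classic, F --> x & m y @[y --> F] --> e x].
Proof.
rewrite in_itv/= le_eqVlt => /andP[/orP[/eqP <- _|ax]].
  exists a^'+; first exact: at_right_proper_filter.
  have Fab : \forall y \near a^'+, y \in `]a, b[.
    near=> y; rewrite in_itv/=; apply/andP; split; near: y;
      [exact: nbhs_right_gt|exact: nbhs_right_lt].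
  have Fa : a^'+ --> a by exact: cvg_within.
  by split=> //; rewrite /extend lexx; exact: (is_cvg_interior_filter (at_right_proper_filter a) Fab Fa).
rewrite le_eqVlt => /orP[/eqP ->|xb].
  exists b^'-; first exact: at_left_proper_filter.
  have Fab : \forall y \near b^'-, y \in `]a, b[.
    near=> y; rewrite in_itv/=; apply/andP; split; near: y;
      [exact: nbhs_left_gt|exact: nbhs_left_lt].
  have Fb : b^'- --> b by exact: cvg_within.
  split=> //; rewrite /extend leNgt ab lexx/=; exact: (is_cvg_interior_filter (at_left_proper_filter b) Fab Fb).
have xab : x \in `]a, b[ by rewrite in_itv/= ax.
exists (nbhs x); first exact: nbhs_pfilter.
split=> //.
- exact: (near_in_itvoo xab).
- rewrite extendE//; apply: differentiable_continuous; apply/derivable1_diffP.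
  by case: (dm xab).
Unshelve. all: by end_near. Qed.

Lemma extend_expanding :
  {in `[a, b] &, forall x y, c * (x - y) ^+ 2 <= s * (e x - e y) * (x - y)}.
Proof.
move=> x y xab yab.
have [F FF [Fab Fx Fe]] := extend_filter xab.
have [G GG [Gab Gy Ge]] := extend_filter yab.
have step u : u \in `]a, b[ -> c * (u - y) ^+ 2 <= s * (m u - e y) * (u - y).
  move=> uab.
  apply: (@ler_cvg_to R G GG R (fun y => c * (u - y) ^+ 2) (fun y => s * (m u - m y) * (u - y))).
  - apply: cvgM; first exact: cvg_cst.
    by apply: (@cvg_comp _ _ _ (fun y => u - y) (fun z => z ^+ 2) G (nbhs (u - y)));
      [apply: cvgB => //; exact: cvg_cst|exact: exprn_continuous].
  - apply: cvgM; last by apply: cvgB => //; exact: cvg_cst.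
    by apply: cvgM; [exact: cvg_cst|apply: cvgB => //; exact: cvg_cst].
  - by apply: filterS Gab => z zab; exact: expm.
apply: (@ler_cvg_to R F FF R (fun x => c * (x - y) ^+ 2) (fun x => s * (m x - e y) * (x - y))).
- apply: cvgM; first exact: cvg_cst.
  by apply: (@cvg_comp _ _ _ (fun x => x - y) (fun z => z ^+ 2) F (nbhs (x - y)));
    [apply: cvgB => //; exact: cvg_cst|exact: exprn_continuous].
- apply: cvgM; last by apply: cvgB => //; exact: cvg_cst.
  by apply: cvgM; [exact: cvg_cst|apply: cvgB => //; exact: cvg_cst].
- by apply: filterS Fab => z zab; exact: step.
Qed.

Lemma extend_inj : {in `[a, b] &, injective e}.
Proof.
move=> x y xab yab exy; have := extend_expanding xab yab.
rewrite exy subrr mulr0 mul0r pmulr_rle0// => h.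
apply/eqP; rewrite -subr_eq0 -sqrf_eq0; apply/eqP/le_anti.
by rewrite h sqr_ge0.
Qed.

Lemma extend_continuous : {within `[a, b], continuous e}.
Proof.
have eqF (F : set_system R) l : Filter F -> F `]a, b[%classic ->
    m x @[x --> F] --> l -> e x @[x --> F] --> l.
  move=> FF Fab; apply: cvg_trans; apply: near_eq_cvg.
  by apply: filterS Fab => y yab; rewrite extendE.
apply/continuous_within_itvP => //; split.
- move=> x xab; apply: eqF; first exact: (near_in_itvoo xab).
  rewrite extendE//; apply: differentiable_continuous; apply/derivable1_diffP.
  by case: (dm xab).
- have Fab : \forall y \near a^'+, y \in `]a, b[.
    near=> y; rewrite in_itv/=; apply/andP; split; near: y;
      [exact: nbhs_right_gt|exact: nbhs_right_lt].
  apply: eqF => //; rewrite /extend lexx.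
  exact: (is_cvg_interior_filter (at_right_proper_filter a) Fab (@cvg_within _ _ _ _)).
- have Fab : \forall y \near b^'-, y \in `]a, b[.
    near=> y; rewrite in_itv/=; apply/andP; split; near: y;
      [exact: nbhs_left_gt|exact: nbhs_left_lt].
  apply: eqF => //; rewrite /extend leNgt ab lexx/=.
  exact: (is_cvg_interior_filter (at_left_proper_filter b) Fab (@cvg_within _ _ _ _)).
Unshelve. all: by end_near. Qed.

Lemma ex_mme (y : R) : exists th, is_mme a b m y th.
Proof.
have cont : {within `[a, b], continuous (fun th => (e th - y) ^+ 2)}.
  move=> x; have ex : {for x, continuous (e : subspace `[a, b] -> R)}.
    exact: extend_continuous.
  have sub : {for e x, continuous (fun z => (z - y) ^+ 2)}.
    apply: (@cvg_comp _ _ _ (fun z => z - y) (fun z => z ^+ 2) _ (nbhs (e x - y))).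
      by apply: cvgB; [exact: cvg_id|exact: cvg_cst].
    exact: exprn_continuous.
  exact: (continuous_comp ex sub).
by have [th thab min] := EVT_min (ltW ab) cont; exists th.
Qed.

Lemma mmeP (y : R) : is_mme a b m y (mme a b m y).
Proof. exact: (xgetPex a (ex_mme y)). Qed.

Lemma mme_itv (y : R) : mme a b m y \in `[a, b].
Proof. by case: (mmeP y). Qed.

(** Because the estimator is monotone in the empirical moment. *)
Lemma measurable_mme : measurable_fun setT (mme a b m).
Proof.
have mono y1 y2 : y1 <= y2 -> 0 <= s * (mme a b m y2 - mme a b m y1).
  rewrite le_eqVlt => /orP[/eqP ->|y12]; first by rewrite subrr mulr0.
  have [t1 h1] := mmeP y1; have [t2 h2] := mmeP y2.
  (* adding the two minimality inequalities bounds (e th2 - e th1) (y2 - y1)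
     from below by 0 *)
  have := h1 _ t2; have := h2 _ t1; have := extend_expanding t2 t1.
  set e1 := e (mme a b m y1); set e2 := e (mme a b m y2).
  set x1 := mme a b m y1; set x2 := mme a b m y2 => h le1 le2.
  have e12 : 0 <= e2 - e1.
    have : 0 <= (e2 - e1) * (y2 - y1) by lra.
    by rewrite pmulr_lge0// subr_gt0.
  case: s1 h => ->; rewrite ?mul1r ?mulN1r => h; rewrite leNgt; apply/negP => x12.
    have : 0 < c * (x2 - x1) ^+ 2 by rewrite mulr_gt0// exprn_even_gt0//= lt_eqF.
    have : 0 <= (e2 - e1) * (x1 - x2) by rewrite mulr_ge0//; lra.
    lra.
  have : 0 < c * (x2 - x1) ^+ 2 by rewrite mulr_gt0// exprn_even_gt0//= gt_eqF//; lra.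
  have : 0 <= (e2 - e1) * (x2 - x1) by rewrite mulr_ge0//; lra.
  lra.
case: s1 mono => -> mono.
  by apply: measurable_realfun.nondecreasing_measurable => // x y /mono; rewrite mul1r subr_ge0.
by apply: measurable_realfun.nonincreasing_measurable => // x y /mono; rewrite mulN1r opprB subr_ge0.
Qed.

(** The criterion vanishes at th, and by injectivity nowhere else. *)
Lemma mme_moment : {in `]a, b[, forall th, mme a b m (m th) = th}.
Proof.
move=> th thab; have thab' := subset_itv_oo_cc thab.
have [t h] := mmeP (m th); apply: extend_inj => //.
have := h _ thab'; rewrite (extendE thab) subrr expr0n/= => le0.
by apply/eqP; rewrite -subr_eq0 -sqrf_eq0 eq_le le0 sqr_ge0.
Qed.

Lemma inverse_moment_moment : {in `]a, b[, cancel m (inverse_moment a b m)}.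
Proof.
move=> th thab; rewrite -(extendE thab) /inverse_moment pinvKV//.
  by move=> x y; rewrite !inE => xab yab; exact: extend_inj.
by rewrite inE/=; exact: subset_itv_oo_cc.
Qed.

Lemma moment_image_itv : is_interval (m @` `]a, b[).
Proof.
move=> _ _ [x xab <-] [y yab <-] z /andP[xz zy].
suff [t txy <-] : exists2 t, t \in `[Num.min x y, Num.max x y] & m t = z.
  exists t => //=; move: xab yab txy; rewrite /= !in_itv/=.
  move=> /andP[ax xb] /andP[ay yb]; rewrite ge_min le_max.
  by move=> /andP[/orP[] h1 /orP[] h2]; apply/andP; split; lra.
have minab : Num.min x y \in `]a, b[ by rewrite minElt; case: ifP.
have maxab : Num.max x y \in `]a, b[ by rewrite maxElt; case: ifP.
apply: IVT; first by rewrite ge_min le_max lexx.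
  exact: (within_continuous_subitv dm).
by have [xy|yx] := leP x y; rewrite ge_min le_max xz zy ?orbT.
Qed.

(** m moves by at least c h on either side of x, in opposite directions. Gives
    both the openness of the image of m and, since c and h are independent of x,
    the uniform radius needed on compact sets. *)
Lemma moment_image_ball (x h y : R) : 0 < h -> x - h \in `]a, b[ ->
  x + h \in `]a, b[ -> `|y - m x| <= c * h -> (m @` `]a, b[) y.
Proof.
move=> h0 xl xr /ler_normlP[yl yr].
have xab : x \in `]a, b[.
  by move: xl xr; rewrite !in_itv/= => /andP[? ?] /andP[? ?]; apply/andP; split; lra.
have := expm xr xab; have := expm xab xl.
rewrite (_ : x - (x - h) = h) 1?(_ : x + h - x = h); [|by ring..].
rewrite expr2 !mulrA !ler_pM2r// => e1 e2.
have [i1|i2] : m (x - h) <= y <= m (x + h) \/ m (x + h) <= y <= m (x - h).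
  case: s1 e1 e2 => ->; rewrite ?mul1r ?mulN1r => e1 e2; [left|right];
    apply/andP; split; lra.
  exact: (moment_image_itv (imageP m xl) (imageP m xr) i1).
exact: (moment_image_itv (imageP m xr) (imageP m xl) i2).
Qed.

End extended_moment.

Section inverse_derivatives.
Context {R : realType} (a b : R) (m G : R -> R) (c : R) (k : nat).
Hypothesis c0 : 0 < c.
Hypothesis dm : {in `]a, b[, forall x : R, is_derive x 1 m (derive1 m x)}.
Hypothesis cm : {in `]a, b[, forall x, c <= `|derive1 m x|}.
Hypothesis bm : bdiff a b k.+1 (derive1 m).
Hypothesis mK : {in `]a, b[, cancel m G}.
Hypothesis open_im : {in `]a, b[, forall x, nbhs (m x) (m @` `]a, b[)}.

Let dG : {in `]a, b[, forall x : R, is_derive (m x) 1 G (derive1 m x)^-1}.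
Proof.
move=> x xab; apply: is_derive_inverse.
- by apply: filterS (near_in_itvoo xab) => y /mK.
- apply: filterS (near_in_itvoo xab) => y yab.
  apply: differentiable_continuous; apply/derivable1_diffP.
  by case: (dm yab).
- exact: dm.
- by rewrite -normr_gt0 (lt_le_trans c0)// cm.
Qed.

(** If G^(i+1) = rho o G near m x then G^(i+2) = (rho' / m') o G there: each
    derivative of G costs one derivative of m, and stays bounded. *)
Lemma inverse_derivative i : (i <= k.+1)%N ->
  (exists2 rho, bdiff a b (k.+1 - i) rho &
    {in `]a, b[, forall x, derive1n i.+1 G (m x) = rho x}) /\
  {in `]a, b[, forall x : R,
    is_derive (m x) 1 (derive1n i G) (derive1n i.+1 G (m x))}.
Proof.
elim: i => [_|i IH ik].
  have d1 : {in `]a, b[, forall x, derive1n 1 G (m x) = (derive1 m x)^-1}.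
    by move=> x xab; rewrite derive1n1 derive1E; case: (dG xab).
  split; last by move=> x xab; rewrite d1//; exact: dG.
  by exists (fun x => (derive1 m x)^-1) => //; rewrite subn0; exact: (bdiffV c0 cm).
have [[rho brho rhoE] _] := IH (ltnW ik).
move: brho; rewrite (_ : (k.+1 - i)%N = (k.+1 - i.+1).+1); last by lia.
move=> [_ [rho' [drho brho']]].
have D : {in `]a, b[, forall x : R, is_derive (m x) 1 (derive1n i.+1 G)
    ((derive1 m x)^-1 * rho' x)}.
  move=> x xab.
  have nE : \forall z \near m x, (rho \o G) z = derive1n i.+1 G z.
    apply: filterS (open_im xab) => _ [z zab <-].
    by rewrite rhoE// [LHS]/= mK.
  apply: (near_eq_is_derive nE); rewrite mulrC.
  apply: is_derive1_comp; last exact: dG.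
  by rewrite mK//; exact: drho.
have DE : {in `]a, b[, forall x,
    derive1n i.+2 G (m x) = (derive1 m x)^-1 * rho' x}.
  by move=> x xab; rewrite derive1nS derive1E; case: (D x xab).
split; last by move=> x xab; rewrite DE//; exact: D.
exists (fun x => (derive1 m x)^-1 * rho' x) => //.
apply: bdiffM => //; apply: (bdiffV c0 cm).
have bmW j : bdiff a b (k.+1 - j) (derive1 m).
  elim: j => [|j IHj]; first by rewrite subn0.
  have [jk|jk] := ltnP j k.+1; last by rewrite (_ : k.+1 - j.+1 = k.+1 - j)%N//; lia.
  by apply: bdiffW; rewrite (_ : (k.+1 - j.+1).+1 = k.+1 - j)%N//; lia.
exact: bmW.
Qed.

Lemma inverse_taylor : (forall x y z, x \in `]a, b[ -> y \in `]a, b[ ->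
    m x <= z <= m y -> exists2 t, t \in `]a, b[ & m t = z) ->
  exists2 C : R, 0 < C & {in `]a, b[ &, forall x y,
    `|y - \sum_(i < k.+1) derive1n i G (m x) / i`!%:R * (m y - m x) ^+ i|
      <= C * `|m y - m x| ^+ k.+1}.
Proof.
move=> conv; have [[rho /bdiff_bounded[C rhoC] rhoE] _] := inverse_derivative (leqnSn k).
exists (Num.max C 1); first by rewrite lt_max ltr01 orbT.
move=> x y xab yab; rewrite -{1}(mK yab).
apply: (@taylor_bound _ (fun i => derive1n i G)) => z zI.
have [t tab <-] : exists2 t, t \in `]a, b[ & m t = z.
  move: zI; rewrite in_itv/=; have [xy|yx] := leP (m x) (m y) => zI.
    exact: (conv x y).
  exact: (conv y x).
split.
  by move=> i ik; apply: (inverse_derivative (leqW ik)).2.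
by rewrite rhoE// le_max rhoC.
Qed.

End inverse_derivatives.

Section method_of_moments_expansion.
Context {R : realType} (a b : R).

Lemma compact_sub_itv (K : set R) : a < b -> compact K -> K `<=` `]a, b[ ->
  exists2 h : R, 0 < h & forall x, K x -> (x - h \in `]a, b[) /\ (x + h \in `]a, b[).
Proof.
move=> ab cK Kab; have [->|/set0P K0] := eqVneq K set0; first by exists 1.
have idK : {within K, continuous (id : R -> R)} by apply: continuous_subspaceT => x.
have [u uK umin] := compact_EVT_min K0 cK idK.
have [v vK vmax] := compact_EVT_max K0 cK idK.
move: uK vK umin vmax; rewrite !inE => uK vK umin vmax.
move: (Kab _ uK) (Kab _ vK); rewrite /= !in_itv/= => /andP[au ub] /andP[av vb].
exists (Num.min (u - a) (b - v) / 2).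
  by rewrite divr_gt0// lt_min !subr_gt0 au.
move=> x xK.
have ux : u <= x by apply: umin; rewrite inE.
have xv : x <= v by apply: vmax; rewrite inE.
set h := Num.min _ _.
have h1 : h <= u - a by rewrite /h ge_min lexx.
have h2 : h <= b - v by rewrite /h ge_min lexx orbT.
have h0 : 0 < h by rewrite /h lt_min !subr_gt0 au.
by rewrite !in_itv/=; split; apply/andP; split; lra.
Qed.

Theorem mme_expansion (m : R -> R) (k : nat) : a < b ->
  condition_L1 a b k m -> condition_L2 a b m ->
  [/\ (forall y, mme a b m y \in `[a, b]),
      measurable_fun setT (mme a b m),
      measurable (m @` `]a, b[),
      (exists2 C : R, 0 < C & forall th y, th \in `]a, b[ -> (m @` `]a, b[) y ->
        `|mme a b m y - (th + \sum_(1 <= l < k.+1) psi a b m l th * (y - m th) ^+ l)|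
          <= C * `|y - m th| ^+ k.+1) &
      forall K : set R, compact K -> K `<=` `]a, b[ ->
        exists2 h : R, 0 < h & forall th y, K th -> `|y - m th| <= h ->
          (m @` `]a, b[) y].
Proof.
move=> ab L1 L2.
have dm := L1_is_derive L1; have bm := L1_bdiff L1.
have [c c0 cm] := L2_inf L2.
have [s s1 expm] := L2_expanding dm cm L2.
have [M mM] := bdiff_bounded bm.
split.
- exact: (mme_itv ab dm mM).
- exact: (measurable_mme ab c0 dm mM s1 expm).
- apply: (@measurable_realfun.is_interval_measurable R).
  exact: (moment_image_itv dm).
- have mK := inverse_moment_moment ab c0 dm mM expm.
  have open_im : {in `]a, b[, forall x, nbhs (m x) (m @` `]a, b[)}.
    move=> x xab.
    have [h h0 /(_ x erefl)[xl xr]] : exists2 h : R, 0 < h &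
        forall z, [set x] z -> (z - h \in `]a, b[) /\ (z + h \in `]a, b[).
      apply: compact_sub_itv => //; first exact: compact_set1.
      by move=> _ ->.
    exists (c * h) => /=; first by rewrite mulr_gt0.
    move=> y /=; rewrite distrC => /ltW yx.
    exact: (moment_image_ball dm s1 expm h0 xl xr yx).
  have [|C C0 taylor] := inverse_taylor c0 dm cm bm mK open_im.
    move=> x y z xab yab xyz.
    by have [t tab <-] := moment_image_itv dm (imageP m xab) (imageP m yab) xyz; exists t.
  exists C => // th _ thab [x xab <-].
  rewrite (mme_moment ab c0 dm mM expm)// (le_trans _ (taylor _ _ thab xab))//.
  rewrite big_ord_recl/= mK// fact0 divr1 expr0 mulr1.
  by rewrite big_add1/= big_mkord /psi.
- move=> K cK Kab; have [h h0 Kh] := compact_sub_itv ab cK Kab.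
  exists (c * h); first by rewrite mulr_gt0.
  move=> th y /Kh[hl hr]; exact: (moment_image_ball dm s1 expm h0 hl hr).
Qed.

End method_of_moments_expansion.

(** * The measure of a counting path *)

Section counting_path_increments.
Context {R : realType} (T : set R) (x : R -> R).
Hypothesis iT : is_interval T.
Hypothesis cx : counting_path T x.

Lemma counting_incr s t : T s -> T t -> s <= t ->
  exists n : nat, x t - x s = n%:R.
Proof. by move=> Ts Tt st; have /natrP := cx.1 s t Ts Tt st. Qed.

Lemma counting_le s t : T s -> T t -> s <= t -> x s <= x t.
Proof.
by move=> Ts Tt /(counting_incr Ts Tt)[n xst]; rewrite -subr_ge0 xst.
Qed.

(** A counting path is constant just before every time, so this computes each
    of its jumps. *)
Lemma jump_const s t l : T s -> T t -> s < t ->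
  (forall v, s <= v < t -> x v = l) -> jump T x t = `|x t - l|.
Proof.
move=> Ts Tt st xl; rewrite /jump ifT; last by apply/asboolP; exists s.
suff -> : lim (x v @[v --> t^'-]) = l by [].
apply/cvg_lim => //; apply: (@cvg_trans _ (cst l @ t^'-)); last exact: cvg_cst.
apply: near_eq_cvg; near=> v; rewrite /cst xl//; apply/andP; split.
  by near: v; exact: nbhs_left_ge.
by near: v; exact: nbhs_left_lt.
Unshelve. all: by end_near. Qed.

Lemma path_measureU (A B : set (measurableTypeR R)) :
  measurable A -> measurable B -> A `&` B = set0 ->
  path_measure T x (A `|` B) = (path_measure T x A + path_measure T x B)%E.
Proof. exact: measureU. Qed.

Let Tmid s t u : T s -> T t -> s <= u <= t -> T u.
Proof. by move=> Ts Tt; exact: iT. Qed.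

Lemma path_measure_const s t : T s -> T t ->
  (forall v, s <= v < t -> x v = x s) ->
  path_measure T x `]s, t[ = 0%E.
Proof.
move=> Ts Tt xc; rewrite /path_measure esum1// => u [+ Tu].
rewrite /= in_itv/= => /andP[su ut].
rewrite (jump_const Ts Tu su (l := x s)); last first.
  by move=> v /andP[sv vu]; rewrite xc// sv (lt_trans vu).
by rewrite xc ?subrr ?normr0// ut ltW.
Qed.

Lemma path_measure_itv_rcons s t : T s -> T t -> s < t ->
  (forall v, s <= v < t -> x v = x s) ->
  path_measure T x `]s, t] = (x t - x s)%:E.
Proof.
move=> Ts Tt st xc.
have -> : `]s, t]%classic = `]s, t[%classic `|` [set t].
  by rewrite setUitv1//= bnd_simp.
rewrite path_measureU//; last first.
  by apply/seteqP; split => // v [/= + vt]; rewrite in_itv/= vt ltxx andbF.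
rewrite path_measure_const// add0e /path_measure.
rewrite (_ : [set t] `&` T = [set t]); last by apply/setIidPl => _ ->.
rewrite esum_set1; last by rewrite lee_fin jump_ge0.
by rewrite (jump_const Ts Tt st xc) ger0_norm// subr_ge0 counting_le// ltW.
Qed.

Lemma path_measure_itv_cat s u t : s <= u -> u <= t ->
  path_measure T x `]s, t] =
  (path_measure T x `]s, u] + path_measure T x `]u, t])%E.
Proof.
move=> su ut; rewrite -path_measureU//.
  by congr (path_measure T x _); rewrite -itv_bndbnd_setU// bnd_simp.
apply/seteqP; split => // v /= []; rewrite !in_itv/= => /andP[_ vu] /andP[uv _].
by rewrite ltNge vu in uv.
Qed.

Lemma path_measure_flat s t : T s -> T t -> s <= t -> x s = x t ->
  path_measure T x `]s, t] = 0%E.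
Proof.
move=> Ts Tt; rewrite le_eqVlt => /orP[/eqP <-|st] xst.
  by rewrite set_itvoc0 measure0.
have xc v : s <= v < t -> x v = x s.
  move=> /andP[sv vt].
  have Tv : T v by apply: (Tmid Ts Tt); rewrite sv ltW.
  apply: le_anti; rewrite (counting_le Ts Tv sv) andbT xst.
  exact: counting_le (ltW vt).
by rewrite path_measure_itv_rcons// xst subrr.
Qed.

(** By induction on the increment N: let u be the first time at which the path
    reaches its final value x t. The path is flat on [u, t], and constant on an
    interval [v, u[ because it takes finitely many values there; all the mass of
    ]v, t] sits at u, and ]s, v] carries a smaller increment. *)
Lemma path_measure_itv s t : T s -> T t -> s <= t ->
  path_measure T x `]s, t] = (x t - x s)%:E.
Proof.
move=> Ts Tt st; have [N] := counting_incr Ts Tt st.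
elim/ltn_ind: N => N IH in t Tt st *.
have [->|N0] := posnP N.
  by move=> /subr0_eq xst; rewrite path_measure_flat ?xst ?subrr.
move=> xst.
pose U := [set v | s <= v <= t /\ x v = x t].
have Ut : U t by split; rewrite ?st ?lexx.
have lU : has_lbound U by exists s => v [/andP[]].
have hU : has_inf U by split => //; exists t.
set u := inf U.
have su : s <= u by apply: lb_le_inf; [exists t|move=> v [/andP[]]].
have ut : u <= t by exact: ge_inf.
have Tu : T u by apply: (Tmid Ts Tt); rewrite su ut.
(* the infimum is attained, by right continuity and because increments are
   integers *)
have xu : x u = x t.
  move: ut; rewrite le_eqVlt => /orP[/eqP ->//|ut].
  have := cx.2 u Tu => /cvgrPdist_lt /(_ 1 ltr01).
  rewrite near_withinE => -[d /= d0 dP].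
  have [v Uv vd] := inf_adherent d0 hU.
  have uv : u <= v by exact: ge_inf.
  move: Uv uv => [/andP[sv vt] xv]; rewrite -xv le_eqVlt => /orP[/eqP ->//|uv].
  have Tv : T v by apply: (Tmid Ts Tt); rewrite sv vt.
  have := dP v; rewrite /= ltr0_norm ?subr_lt0// opprB ltrBlDl.
  move=> /(_ vd uv Tv).
  have [n xuv] := counting_incr Tu Tv (ltW uv).
  rewrite distrC xuv normr_nat ltrn1 => n1; have n0 : n = 0%N by lia.
  by apply/esym/eqP; rewrite -subr_eq0 xuv n0.
have xsu : x s <> x u.
  by rewrite xu => xst'; move: xst; rewrite xst' subrr => /esym/eqP; rewrite pnatr_eq0; lia.
have {}su : s < u by rewrite lt_neqAle su andbT; apply/eqP => /(congr1 x).
(* v realises the largest value of x before u *)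
pose P n := `[< exists2 v, s <= v < u & x v - x s = n%:R >].
have exP : exists n, P n.
  by exists 0%N; apply/asboolP; exists s; rewrite ?lexx ?su ?subrr.
have PN n : P n -> (n <= N)%N.
  move=> /asboolP[v /andP[sv vu] xv].
  have Tv : T v by apply: (Tmid Ts Tu); rewrite sv ltW.
  rewrite -(ler_nat R) -xst -xv lerB//.
  by rewrite counting_le// ltW// (lt_le_trans vu).
have [n /asboolP[v /andP[sv vu] xv] nmax] := ex_maxnP exP PN.
have Tv : T v by apply: (Tmid Ts Tu); rewrite sv ltW.
have vE w : v <= w < u -> x w = x v.
  move=> /andP[vw wu].
  have Tw : T w by apply: (Tmid Ts Tu); rewrite (le_trans sv vw) ltW.
  have [j xw] := counting_incr Ts Tw (le_trans sv vw).
  have jn : (j <= n)%N.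
    by apply: nmax; apply/asboolP; exists w => //; rewrite (le_trans sv vw) wu.
  apply: le_anti; rewrite (counting_le Tv Tw vw) andbT.
  by rewrite -(lerD2r (- x s)) xw xv ler_nat.
have nN : (n < N)%N.
  rewrite ltn_neqAle PN ?andbT; last by apply/asboolP; exists v; rewrite ?sv.
  apply/eqP => nN;
  have vt : x v = x t by apply/eqP; rewrite -(subr_eq0 (x v)) -(subrKA (x s)); apply/eqP; rewrite xv nN -xst; ring.
  have : u <= v by apply: ge_inf => //; split => //; rewrite sv/= (ltW (lt_le_trans vu ut)).
  by rewrite leNgt vu.
rewrite (path_measure_itv_cat (ltW su) ut) (path_measure_flat Tu Tt ut xu) adde0.
rewrite (path_measure_itv_cat sv (ltW vu)) (IH n)//.
by rewrite path_measure_itv_rcons// -EFinD xu; congr EFin; ring.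
Qed.

End counting_path_increments.

(** * Mean measures and Campbell's formula *)

Section nonneg_induction.
Context {d} {X : measurableType d} {R : realType}.
Local Open Scope ereal_scope.
Import HBNNSimple.

(** Two functionals of nonnegative measurable functions that are additive,
    homogeneous and continuous along increasing sequences coincide as soon as
    they coincide on indicators; stated as an induction principle since some of
    the functionals below are not integrals against a given measure. *)
Lemma ge0_measurable_ind (Q : (X -> \bar R) -> Prop) :
  (forall A, measurable A -> Q (fun x => (\1_A x)%:E)) ->
  (forall (r : R) (f : X -> \bar R), (0 <= r)%R -> measurable_fun setT f ->
    (forall x, 0 <= f x) -> Q f -> Q (fun x => r%:E * f x)) ->
  (forall f g : X -> \bar R, measurable_fun setT f -> (forall x, 0 <= f x) ->
    measurable_fun setT g -> (forall x, 0 <= g x) ->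
    Q f -> Q g -> Q (fun x => f x + g x)) ->
  (forall F : nat -> X -> \bar R, (forall n, measurable_fun setT (F n)) ->
    (forall n x, 0 <= F n x) -> (forall x, nondecreasing_seq (F ^~ x)) ->
    (forall n, Q (F n)) -> Q (fun x => limn (F ^~ x))) ->
  forall f : X -> \bar R, measurable_fun setT f -> (forall x, 0 <= f x) -> Q f.
Proof.
move=> Q1 QZ QD Qlim f mf f0.
pose F n := EFin \o nnsfun_approx measurableT mf n.
have -> : f = fun x => limn (F ^~ x).
  by apply/funext => x; apply/esym/cvg_lim => //; exact: cvg_nnsfun_approx.
apply: Qlim => [n|n x|x|n].
- by apply/measurable_EFinP.
- by rewrite lee_fin.
- by move=> i j ij; rewrite lee_fin; exact/lefP/nd_nnsfun_approx.
rewrite /F; move: (nnsfun_approx _ _ _) => h {F}.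
pose ys : seq R := finmap.enum_fset (fset_set (range h)).
pose t n x := (\sum_(i < n)
  (ys`_i * \1_(h @^-1` [set ys`_i]) x)%R)%:E.
suff H k : (k <= size ys)%N ->
    [/\ measurable_fun setT (t k), (forall x, 0 <= t k x) & Q (t k)].
  have [_ _] := H _ (leqnn _).
  by congr Q; apply/funext => x; rewrite /t -fimfunEord.
elim: k => [_|k IH nh].
  have t0 : t 0%N = fun x => (\1_set0 x)%:E.
    by apply/funext => x; rewrite /t big_ord0 indicE in_set0.
  split.
  - by rewrite t0; exact/measurable_EFinP.
  - by move=> x; rewrite t0 lee_fin.
  - by rewrite t0; apply: Q1.
have [mt t0 Qt] := IH (ltnW nh).
set y := (ys`_k)%R.
have y0 : (0 <= y)%R.
  have : y \in ys by rewrite mem_nth.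
  by rewrite /ys in_fset_set// inE => -[x _ <-].
have mh : measurable (h @^-1` [set y]) by exact: measurable_funPTI.
have tS : t k.+1 = fun x => t k x + y%:E * (\1_(h @^-1` [set y]) x)%:E.
  by apply/funext => x; rewrite /t big_ord_recr/= EFinD EFinM.
have m1 : measurable_fun setT (fun x => y%:E * (\1_(h @^-1` [set y]) x)%:E).
  by apply/measurable_EFinP; apply: measurable_funM.
have p1 x : 0 <= y%:E * (\1_(h @^-1` [set y]) x)%:E by rewrite -EFinM lee_fin mulr_ge0.
split.
- by rewrite tS; exact: emeasurable_funD.
- by move=> x; rewrite tS adde_ge0.
- rewrite tS; apply: QD => //; apply: QZ => //.
  exact/measurable_EFinP.
exact: Q1.
Qed.

End nonneg_induction.

Section mean_measure.
Context {d} {Omega : measurableType d} {R : realType}.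
Context (P : probability Omega R).
Context (N : Omega -> {measure set (measurableTypeR R) -> \bar R}).
Context (rho : {measure set (measurableTypeR R) -> \bar R}).
Local Open Scope ereal_scope.

(** Measurability and the value of the mean are propagated together because
    the same Dynkin argument proves both. *)
Definition has_mean (A : set (measurableTypeR R)) :=
  measurable_fun setT (fun w => N w A) /\ \int[P]_w N w A = rho A.

Lemma has_mean_bigcup (F : (set (measurableTypeR R))^nat) :
  (forall n, measurable (F n)) -> trivIset setT F ->
  (forall n, has_mean (F n)) -> has_mean (\bigcup_n F n).
Proof.
move=> mF tF HF.
have NE w : N w (\bigcup_n F n) = \sum_(n <oo) N w (F n).
  by rewrite measure_semi_bigcup//; exact: bigcupT_measurable.
split.
  under eq_fun do rewrite NE.
  apply: (ge0_emeasurable_sum (P := xpredT)) => // n _; exact: (HF n).1.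
under eq_integral do rewrite NE.
rewrite integral_nneseries//; last by move=> n; exact: (HF n).1.
rewrite measure_semi_bigcup//; last exact: bigcupT_measurable.
by apply: eq_eseriesr => n _; exact: (HF n).2.
Qed.

(** A Dynkin class argument, which needs the finiteness of both measures on J
    to handle complements. *)
Lemma has_mean_local (J : set (measurableTypeR R)) : measurable J ->
  (forall w, N w J < +oo) -> rho J < +oo ->
  (forall x y : R, has_mean (`]x, y] `&` J)) -> has_mean J ->
  forall A, measurable A -> has_mean (A `&` J).
Proof.
move=> mJ NJ rhoJ Hitv HJ A mA.
apply: (@dynkin_induction _ (measurableTypeR R) (@ocitv R) (fun A => has_mean (A `&` J))) => //.
- exact: ocitvI.
- by rewrite setTI.
- by move=> _ [[x y] _ <-]; exact: Hitv.
- move=> S mS [mNS NS].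
  have NE w : N w (~` S `&` J) = N w J - N w (S `&` J).
    rewrite (_ : ~` S `&` J = J `\` S); last by rewrite setDE setIC.
    by rewrite measureD ?(setIC J)//; exact: NJ.
  split.
    by under eq_fun do rewrite NE; apply: emeasurable_funB => //; exact: HJ.1.
  under eq_integral do rewrite NE.
  rewrite integralB//.
  + rewrite HJ.2 NS (_ : ~` S `&` J = J `\` S); last by rewrite setDE setIC.
    by rewrite measureD// setIC.
  + apply/integrableP; split; first exact: HJ.1.
    by under eq_integral do rewrite gee0_abs//; rewrite HJ.2.
  + apply/integrableP; split => //.
    under eq_integral do rewrite gee0_abs//; rewrite NS.
    by rewrite (le_lt_trans _ rhoJ)// le_measure// ?inE//; exact: measurableI.
- move=> F mF tF HF; rewrite setI_bigcupl; apply: has_mean_bigcup => //.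
  + by move=> n; exact: measurableI.
  + exact: trivIset_setIr.
Qed.

Lemma has_mean_cover (J : (set (measurableTypeR R))^nat) :
  (forall n, measurable (J n)) ->
  (forall n A, measurable A -> has_mean (A `&` J n)) ->
  (forall w A, measurable A -> N w A = N w (A `&` \bigcup_n J n)) ->
  (forall A, measurable A -> rho A = rho (A `&` \bigcup_n J n)) ->
  forall A, measurable A -> has_mean A.
Proof.
move=> mJ HJ NJ rhoJ A mA.
have mD n : measurable (seqDU J n).
  by apply: measurableD => //; exact: bigsetU_measurable.
have : has_mean (A `&` \bigcup_n J n).
  rewrite seqDU_bigcup_eq setI_bigcupr; apply: has_mean_bigcup.
  - by move=> n; exact: measurableI.
  - exact/trivIset_setIl/trivIset_seqDU.
  - move=> n; rewrite (_ : A `&` seqDU J n = A `&` seqDU J n `&` J n).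
      by apply: HJ; exact: measurableI.
    apply/seteqP; split => [x [Ax [Jx nx]]|x [[Ax ?] _]] //.
have -> : has_mean (A `&` \bigcup_n J n) = has_mean A; last by [].
by rewrite /has_mean -rhoJ//; under eq_fun do rewrite -NJ//.
Qed.

Lemma campbell : (forall A, measurable A -> has_mean A) ->
  forall h : R -> \bar R, measurable_fun setT h -> (forall x, 0 <= h x) ->
  \int[P]_w (\int[N w]_x h x) = \int[rho]_x h x.
Proof.
move=> H; have mN (h : R -> \bar R) : measurable_fun setT h -> (forall x, 0 <= h x) ->
    measurable_fun setT (fun w => \int[N w]_x h x).
  move=> mh h0.
  by apply: measurable_fun_integral_kernel => // A /H[].
apply: ge0_measurable_ind.
- move=> A mA; rewrite integral_indic// setIT -(H A mA).2.
  by apply: eq_integral => w _; rewrite integral_indic// setIT.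
- move=> r f r0 mf f0 IH.
  have E (mu : {measure set (measurableTypeR R) -> \bar R}) :
      \int[mu]_x (r%:E * f x) = r%:E * \int[mu]_x f x by rewrite ge0_integralZl.
  rewrite E -IH -ge0_integralZl//; first by apply: eq_integral => w _; rewrite E.
  + exact: mN.
  + by move=> w _; exact: integral_ge0.
- move=> f g mf f0 mg g0 If Ig.
  have E (mu : {measure set (measurableTypeR R) -> \bar R}) :
      \int[mu]_x (f x + g x) = \int[mu]_x f x + \int[mu]_x g x.
    by rewrite ge0_integralD.
  rewrite E -If -Ig -ge0_integralD//; first by apply: eq_integral => w _; rewrite E.
  + by move=> w _; exact: integral_ge0.
  + exact: mN.
  + by move=> w _; exact: integral_ge0.
  + exact: mN.
- move=> F mF F0 ndF IH.
  have E (mu : {measure set (measurableTypeR R) -> \bar R}) :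
      \int[mu]_x limn (F ^~ x) = limn (fun n => \int[mu]_x F n x).
    by rewrite monotone_convergence// => x _; exact: ndF.
  rewrite E; transitivity (\int[P]_w limn (fun n => \int[N w]_x F n x)).
    by apply: eq_integral => w _; rewrite E.
  rewrite monotone_convergence//.
  + by congr (limn _); apply/funext => n; exact: IH.
  + by move=> n; exact: mN.
  + by move=> n w _; exact: integral_ge0.
  + move=> w _ i j ij; apply: ge0_le_integral => //; do ?exact: mF.
    by move=> x _; exact: ndF.
Qed.

End mean_measure.

(** * The mean measure of a Poisson process *)

Section interval_cover.
Context {R : realType}.

(** A maximum of T, if any, has to be treated apart: no rational number
    separates it from the other points. *)
Lemma cofinal_seq (T : set R) (t0 : R) : T t0 ->
  exists f : nat -> R, (forall i, T (f i)) /\ (forall u, T u -> exists i, u <= f i).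
Proof.
move=> Tt0; have [[M [TM MT]]|noM] := pselect (exists M, T M /\ forall u, T u -> u <= M).
  by exists (fun=> M); split => // u /MT uM; exists 0%N.
have /choice[g gP] (q : rat) : exists v, T v /\
    forall v', T v' -> ratr q < v' -> ratr q < v.
  have [[v [Tv qv]]|no] := pselect (exists v, T v /\ ratr q < v); first by exists v.
  by exists t0; split => // v' Tv' qv'; case: no; exists v'.
exists (fun i => if unpickle i is Some q then g q else t0); split.
  by move=> i; case: unpickle => // q; exact: (gP q).1.
move=> u Tu; have [v Tv uv] : exists2 v, T v & u < v.
  apply: contrapT => no; apply: noM; exists u; split => // v Tv.
  by rewrite leNgt; apply/negP => uv; apply: no; exists v.
have [q] := rat_in_itvoo uv; rewrite in_itv/= => /andP[uq qv].
exists (pickle q); rewrite pickleK (le_trans (ltW uq))// ltW//.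
exact: ((gP q).2 v Tv qv).
Qed.

(** Intervals ]s, t] with end points in T exhaust T, its minimum excepted; that
    point carries neither jumps nor Lebesgue mass. The increments of the process
    only give information on such intervals, and the intensity may fail to be
    integrable on all of T. *)
Lemma interval_cover (T : set R) (t0 : R) : T t0 ->
  exists J : nat -> R * R,
    (forall n, [/\ T (J n).1, T (J n).2 & (J n).1 <= (J n).2]) /\
    forall s u, T s -> T u -> s < u -> exists n, u \in `](J n).1, (J n).2].
Proof.
move=> Tt0; have [h [Th hP]] := cofinal_seq Tt0.
have [f [Tf fP]] : exists f : nat -> R, (forall i, T (f i)) /\
    (forall u, T u -> exists i, f i <= u).
  have [|f [Tf fP]] := @cofinal_seq [set u | T (- u)] (- t0).
    by rewrite /= opprK.
  exists (fun i => - f i); split => // u Tu.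
  by have [|i fi] := fP (- u); [rewrite /= opprK|exists i; rewrite lerNl].
pose J n := if @unpickle (nat * nat)%type n is Some (i, j) then
  if f i <= h j then (f i, h j) else (t0, t0) else (t0, t0).
exists J; split.
  by move=> n; rewrite /J; case: unpickle => [[i j]|]; [case: ifPn => fh|]; split => /=.
move=> s u Ts Tu su; have [i fi] := fP s Ts; have [j hj] := hP u Tu.
have fu : f i < u by exact: le_lt_trans su.
exists (pickle (i, j)); rewrite /J pickleK (le_trans (ltW fu) hj)/=.
by rewrite in_itv/= fu.
Qed.

End interval_cover.

Section density_measure.
Context {R : realType}.
Local Open Scope ereal_scope.
Local Notation mu := (@lebesgue_measure R).

Lemma ex_density_measure (f : R -> R) :
  measurable_fun setT f -> (forall x, 0 <= f x)%R ->
  exists rho : {measure set (measurableTypeR R) -> \bar R},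
    (forall A, measurable A -> rho A = \int[mu]_(x in A) (f x)%:E) /\
    (forall h : R -> \bar R, measurable_fun setT h -> (forall x, 0 <= h x) ->
      \int[rho]_x h x = \int[mu]_x (h x * (f x)%:E)).
Proof.
move=> mf f0; have mfE : measurable_fun setT (EFin \o f) by exact/measurable_EFinP.
have fE0 x : 0 <= (f x)%:E by rewrite lee_fin.
pose r (A : set (measurableTypeR R)) := \int[mu]_(x in A) (f x)%:E.
have r0 : r set0 = 0 by rewrite /r integral_set0.
have rge0 A : 0 <= r A by exact: integral_ge0.
have rsig : semi_sigma_additive r.
  move=> F mF tF mUF; rewrite /r ge0_integral_bigcup//; last exact: measurable_funTS.
  apply: is_cvg_nneseries => n _ _; exact: rge0.
pose rho : {measure set (measurableTypeR R) -> \bar R} :=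
  HB.pack r (isMeasure.Build _ _ _ r r0 rge0 rsig).
exists rho; split => // h mh h0; move: h mh h0.
have mM (h : R -> \bar R) : measurable_fun setT h ->
    measurable_fun setT (fun x => h x * (f x)%:E) by move=> mh; exact: emeasurable_funM.
apply: ge0_measurable_ind.
- move=> A mA; rewrite integral_indic// setIT/= /r integral_mkcond.
  apply: eq_integral => x _; rewrite /patch indicE.
  by case: (x \in A); rewrite ?mul1e ?mul0e.
- move=> c h c0 mh h0 IH; rewrite ge0_integralZl// IH -ge0_integralZl//.
  + by apply: eq_integral => x _; rewrite muleA.
  + exact: mM.
  + by move=> x _; exact: mule_ge0.
- move=> g h mg g0 mh h0 Ig Ih; rewrite ge0_integralD// Ig Ih -ge0_integralD//.
  + by apply: eq_integral => x _; rewrite ge0_muleDl.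
  + by move=> x _; exact: mule_ge0.
  + exact: mM.
  + by move=> x _; exact: mule_ge0.
  + exact: mM.
- move=> F mF F0 ndF IH; rewrite monotone_convergence//.
  under eq_fun do rewrite IH.
  rewrite -monotone_convergence//.
  + apply: eq_integral => x _; rewrite limeMr//; apply: ereal_nondecreasing_is_cvgn; exact: ndF.
  + by move=> n; exact: mM.
  + by move=> n x _; exact: mule_ge0.
  + by move=> x _ i j ij; rewrite lee_wpmul2r//; exact: ndF.
Qed.

End density_measure.

Section exponential_series.
Context {R : realType}.
Local Open Scope ereal_scope.

Lemma nneseries_exp (z : R) : (0 <= z)%R ->
  \sum_(c <oo) (z ^+ c / c`!%:R)%:E = (expR z)%:E.
Proof.
move=> z0; rewrite (_ : expR z = limn (series (exp_coeff z))); last by rewrite expRE /pseries -exp_coeffE.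
rewrite -EFin_lim; last exact: is_cvg_series_exp_coeff.
by apply/congr_lim/funext => n /=; rewrite /series/= -sumEFin.
Qed.

(** The term c = 0 vanishes and c / c! = 1 / (c - 1)!. *)
Lemma nneseries_exp_mean (z : R) : (0 <= z)%R ->
  \sum_(c <oo) (c%:R * (z ^+ c / c`!%:R))%:E = (z * expR z)%:E.
Proof.
move=> z0; rewrite EFinM -nneseries_exp// -nneseriesZl; last first.
  by move=> c _; rewrite lee_fin divr_ge0// exprn_ge0.
rewrite (nneseries_split 0 1); last first.
  by move=> c _; rewrite lee_fin mulr_ge0// divr_ge0// exprn_ge0.
rewrite add0n big_nat1 mul0r add0e -nneseries_addn; last first.
  by move=> c; rewrite lee_fin mulr_ge0// divr_ge0// exprn_ge0.
apply: eq_eseriesr => c _; rewrite -EFinM addn1 factS natrM exprS; congr EFin.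
have c0 : (c.+1)%:R != 0%R :> R by rewrite pnatr_eq0.
have f0 : (c`!)%:R != 0%R :> R by rewrite pnatr_eq0 -lt0n fact_gt0.
by field; apply/andP.
Qed.

End exponential_series.

Section poisson_increment.
Context {d} {Omega : measurableType d} {R : realType} (P : probability Omega R).
Context (Y : Omega -> R) (z : R).
Local Open Scope ereal_scope.
Hypothesis mY : measurable_fun setT Y.
Hypothesis z0 : (0 <= z)%R.
Hypothesis Ynat : forall w, exists n : nat, Y w = n%:R.
Hypothesis YP : forall c : nat, P [set w | Y w = c%:R] = poisson_prob z 0 [set c].

(** The formula also covers rate 0, where 0 ^+ 0 = 1 makes it a unit mass. *)
Lemma poisson_prob1 c : poisson_prob z 0 [set c] = (expR (- z) * (z ^+ c / c`!%:R))%:E.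
Proof.
rewrite /poisson_prob; case: ifPn => [zp|].
  rewrite esum_set1 ?lee_fin ?poisson_pmf_ge0// /poisson_pmf zp.
  by congr EFin; ring.
rewrite -leNgt => z0'; have -> : z = 0%R by apply: le_anti; rewrite z0 z0'.
rewrite diracE oppr0 expR0 mul1r; case: c => [|c].
  by rewrite expr0 fact0 divr1 mem_set.
by rewrite expr0n/= mul0r memNset.
Qed.

Lemma poisson_expectation (phi : R -> R) : measurable_fun setT phi ->
  (forall x, 0 <= phi x)%R ->
  \int[P]_w (phi (Y w))%:E =
  (expR (- z))%:E * \sum_(c <oo) (phi c%:R * (z ^+ c / c`!%:R))%:E.
Proof.
move=> mphi phi0; pose A c := [set w | Y w = c%:R].
have mA c : measurable (A c).
  by rewrite -[A c]setTI; exact: (mY measurableT (measurable_set1 c%:R)).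
have mphiY : measurable_fun setT (fun w => (phi (Y w))%:E).
  by apply/measurable_EFinP; exact: measurableT_comp.
have AT : \bigcup_c A c = setT.
  by apply/seteqP; split => // w _; have [n Yn] := Ynat w; exists n.
have tA : trivIset setT A.
  move=> i j _ _ [w [wi wj]]; apply/eqP.
  by rewrite -(eqr_nat R) -wi -wj.
rewrite -nneseriesZl; last first.
  by move=> c _; rewrite lee_fin mulr_ge0// divr_ge0// exprn_ge0.
rewrite -AT ge0_integral_bigcup ?AT//; last by move=> w _; rewrite lee_fin.
apply: eq_eseriesr => c _.
rewrite (_ : \int[P]_(w in A c) _ = \int[P]_(w in A c) (phi c%:R)%:E); last first.
  by apply: eq_integral => w; rewrite inE => ->.
transitivity ((phi c%:R)%:E * P (A c)); first exact: integral_cst.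
rewrite /A YP poisson_prob1 -!EFinM.
by congr EFin; ring.
Qed.

Lemma poisson_mean : \int[P]_w (Y w)%:E = z%:E.
Proof.
rewrite (_ : \int[P]_w (Y w)%:E = \int[P]_w (Num.max (Y w) 0)%:E); last first.
  apply: eq_integral => w _; have [n ->] := Ynat w.
  by rewrite max_l.
rewrite (poisson_expectation (phi := fun y => Num.max y 0%R)); last 2 first.
- exact: measurable_maxr.
- by move=> y; rewrite le_max lexx orbT.
under eq_eseriesr => c _ do rewrite max_l//.
rewrite nneseries_exp_mean// -EFinM; congr EFin.
by rewrite mulrCA -expRD addNr expR0 mulr1.
Qed.

Lemma poisson_mgf (th : R) :
  \int[P]_w (expR (th * Y w))%:E = (expR (z * (expR th - 1)))%:E.
Proof.
rewrite (poisson_expectation (phi := fun y => expR (th * y))); last 2 first.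
- by apply: measurableT_comp => //; exact: measurable_funM.
- by move=> y; exact: expR_ge0.
rewrite (eq_eseriesr (g := fun c => ((z * expR th) ^+ c / c`!%:R)%:E)); last first.
  move=> c _; rewrite exprMn expRM_natr.
  by congr EFin; ring.
rewrite nneseries_exp ?mulr_ge0 ?expR_ge0// -EFinM -expRD.
by congr (expR _)%:E; ring.
Qed.

End poisson_increment.

(** The set is coerced to the measurable type on which path measures live. *)
Definition ocitv_of {R : realType} (s : R * R) : set (measurableTypeR R) :=
  `]s.1, s.2]%classic.

Lemma measurable_ocitv_of {R : realType} (s : R * R) : measurable (ocitv_of s).
Proof. exact: measurable_itv. Qed.

Section intensity_measure.
Context {R : realType} (T : set R) (l : R -> R).
Hypothesis iT : is_interval T.
Hypothesis hl : intensity_function T l.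
Local Open Scope ereal_scope.
Local Notation leb := (@lebesgue_measure R).

Definition rate (s t : R) : R := (\int[leb]_(u in `]s, t]) l u)%R.

Let itvT s t : T s -> T t -> `]s, t] `<=` T.
Proof.
by move=> Ts Tt u /=; rewrite in_itv/= => /andP[/ltW su ut]; apply: (iT Ts Tt); rewrite su.
Qed.

Lemma rate_ge0 s t : T s -> T t -> (0 <= rate s t)%R.
Proof. by move=> Ts Tt; apply: Rintegral_ge0 => u /(itvT Ts Tt) Tu; case: hl => + _ _; exact. Qed.

Lemma rateE s t : T s -> T t -> \int[leb]_(u in `]s, t]) (l u)%:E = (rate s t)%:E.
Proof.
move=> Ts Tt; rewrite /rate /Rintegral fineK//.
apply: integrable_fin_num => //; case: hl => _ _ /(_ s t Ts Tt).
by apply: integrableS => //; exact: subset_itv_oc_cc.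
Qed.

(** The measure rho is lambda dt restricted to T. The remaining clauses record
    all that is needed of it: its values on the intervals that the process sees,
    the fact that countably many of them carry it, and integration. *)
Lemma intensity_measure (t0 : R) : T t0 ->
  exists (rho : {measure set (measurableTypeR R) -> \bar R}) (J : nat -> R * R),
  [/\ (forall n, [/\ T (J n).1, T (J n).2 & ((J n).1 <= (J n).2)%R]),
      (forall s u, T s -> T u -> (s < u)%R -> exists n, ocitv_of (J n) u),
      (forall s t, T s -> T t -> rho (ocitv_of (s, t)) = (rate s t)%:E),
      (forall A, measurable A -> rho A = rho (A `&` \bigcup_n ocitv_of (J n))) &
      forall h : R -> \bar R, measurable_fun setT h -> (forall x, 0 <= h x) ->
        \int[rho]_x h x = \int[leb]_(x in T) (h x * (l x)%:E)].
Proof.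
move=> Tt0; have [l0 ml il] := hl.
have mT : measurable T by exact: is_interval_measurable.
have mlT : measurable_fun setT (l \_ T) by exact: (measurable_restrictT l mT).1.
have lT0 x : (0 <= (l \_ T) x)%R.
  by rewrite patchE; case: ifPn => //; rewrite inE => /l0.
have [rho [rhoE rhoI]] := ex_density_measure mlT lT0.
have [J [JT JP]] := interval_cover Tt0.
exists rho, J; split => //.
- move=> s t Ts Tt; rewrite rhoE; last exact: measurable_ocitv_of.
  rewrite -rateE//; apply: eq_integral => u.
  by rewrite inE => /(itvT Ts Tt) Tu; rewrite patchE mem_set.
- move=> A mA; set U := \bigcup_n _.
  have mU : measurable U by apply: bigcupT_measurable => n; exact: measurable_ocitv_of.
  have E : rho A = rho (A `\` U) + rho (A `&` U) := measureDI rho mA mU.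
  suff r0 : rho (A `\` U) = 0 by rewrite E r0 add0e.
  rewrite rhoE; last exact: measurableD.
  (* what the intervals miss is at most the minimum of T *)
  have [[x0 [[Ax0 Ux0] Tx0]]|no] := pselect (((A `\` U) `&` T) !=set0).
    rewrite integral_mkcond; transitivity (\int[leb]_(x in [set x0]) (l \_ T x)%:E);
      last exact: integral_set1.
    rewrite [RHS]integral_mkcond; apply: eq_integral => x _; rewrite !patchE.
    case: (boolP (x \in T)) => [|nTx]; last by do 2 case: ifP.
    rewrite inE => Tx; case: ifPn => [|nAU].
      rewrite inE => -[Ax Ux].
      rewrite ifT//; apply/mem_set => /=; apply/eqP; rewrite eq_le !leNgt.
      apply/andP; split; apply/negP => xx0.
        by apply: Ux; have [n] := JP _ _ Tx0 Tx xx0; exists n.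
      by apply: Ux0; have [n] := JP _ _ Tx Tx0 xx0; exists n.
    case: ifPn => //; rewrite inE/= => xx0.
    by move: nAU; rewrite notin_setE => -[]; rewrite xx0.
  apply: integral0_eq => x AUx; rewrite patchE; case: ifPn => //; rewrite inE => Tx.
  by case: no; exists x.
- move=> h mh h0; rewrite rhoI// [RHS]integral_mkcond; apply: eq_integral => x _.
  by rewrite !patchE; case: ifPn => //; rewrite mule0.
Qed.

End intensity_measure.

Section poisson_mean_measure.
Context {d} {Omega : measurableType d} {R : realType} (P : probability Omega R).
Context (T : set R) (l : R -> R) (X : R -> Omega -> R).
Hypothesis iT : is_interval T.
Hypothesis hl : intensity_function T l.
Hypothesis pX : poisson_process P T l X.
Hypothesis mX : forall t, measurable_fun setT (X t).
Local Open Scope ereal_scope.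

Let cX w : counting_path T (X ^~ w). Proof. by case: pX. Qed.

Lemma poisson_incr_nat s t : T s -> T t -> (s <= t)%R ->
  forall w, exists n : nat, (X t w - X s w = n%:R)%R.
Proof. by move=> Ts Tt st w; exact: (counting_incr (cX w)). Qed.

Lemma measurable_incr s t : measurable_fun setT (fun w => X t w - X s w)%R.
Proof. exact: measurable_funB. Qed.

Lemma poisson_incr_mean s t : T s -> T t -> (s < t)%R ->
  \int[P]_w (X t w - X s w)%:E = (rate l s t)%:E.
Proof.
move=> Ts Tt st; apply: (@poisson_mean _ _ _ P (fun w => X t w - X s w)%R).
- exact: measurable_incr.
- exact: (rate_ge0 iT hl Ts Tt).
- exact: poisson_incr_nat (ltW st).
- by case: pX => _ _ /(_ s t Ts Tt st).
Qed.

Lemma poisson_incr_mgf s t th : T s -> T t -> (s < t)%R ->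
  \int[P]_w (expR (th * (X t w - X s w))%R)%:E = (expR (rate l s t * (expR th - 1))%R)%:E.
Proof.
move=> Ts Tt st; apply: (@poisson_mgf _ _ _ P (fun w => X t w - X s w)%R).
- exact: measurable_incr.
- exact: (rate_ge0 iT hl Ts Tt).
- exact: poisson_incr_nat (ltW st).
- by case: pX => _ _ /(_ s t Ts Tt st).
Qed.

Let N w : {measure set (measurableTypeR R) -> \bar R} := path_measure T (X ^~ w).

Lemma path_measure_cover (J : nat -> R * R) w A :
  (forall s u, T s -> T u -> (s < u)%R -> exists n, ocitv_of (J n) u) ->
  N w A = N w (A `&` \bigcup_n ocitv_of (J n)).
Proof.
move=> JP; change (path_measure T (X ^~ w) A =
  path_measure T (X ^~ w) (A `&` \bigcup_n ocitv_of (J n))).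
rewrite /path_measure esum_mkcond [RHS]esum_mkcond.
apply: eq_esum => u _; case: ifPn => [|nuA]; last first.
  rewrite ifF//; apply/negbTE; move: nuA; rewrite !notin_setE => nuA [[Au _] Tu].
  exact: nuA.
rewrite inE => uA; case: ifPn => // nuJ; rewrite /jump; case: asboolP => // -[s Ts su].
move: nuJ; rewrite notin_setE => -[]; case: uA => Au Tu; split => //; split => //.
by have [n] := JP _ _ Ts Tu su; exists n.
Qed.

Context (rho : {measure set (measurableTypeR R) -> \bar R}) (J : nat -> R * R).
Hypothesis JT : forall n, [/\ T (J n).1, T (J n).2 & ((J n).1 <= (J n).2)%R].
Hypothesis JP : forall s u, T s -> T u -> (s < u)%R -> exists n, ocitv_of (J n) u.
Hypothesis rhoE : forall s t, T s -> T t -> rho (ocitv_of (s, t)) = (rate l s t)%:E.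
Hypothesis rhoJ : forall A, measurable A -> rho A = rho (A `&` \bigcup_n ocitv_of (J n)).

Lemma poisson_has_mean A : measurable A -> has_mean P N rho A.
Proof.
have Hitv s t : (s < t -> T s /\ T t)%R -> has_mean P N rho (ocitv_of (s, t)).
  have [ts _|st /(_ isT)[Ts Tt]] := leP t s.
    have e : ocitv_of (s, t) = set0.
      by rewrite /ocitv_of set_itv_ge// bnd_simp -leNgt.
    split; first by rewrite e; under eq_fun do rewrite measure0; exact: measurable_cst.
    by rewrite e measure0; under eq_integral do rewrite measure0; rewrite integral0.
  have NE w : N w (ocitv_of (s, t)) = (X t w - X s w)%:E by exact: path_measure_itv (ltW st).
  split.
    by under eq_fun do rewrite NE; apply/measurable_EFinP; exact: measurable_incr.
  by under eq_integral do rewrite NE; rewrite rhoE// poisson_incr_mean.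
apply: (@has_mean_cover _ _ _ P N rho (fun n => ocitv_of (J n))).
- by move=> n; exact: measurable_ocitv_of.
- move=> n B mB; have [J1 J2 J12] := JT n.
  apply: has_mean_local => //.
  + exact: measurable_ocitv_of.
  + move=> w; rewrite (_ : N w _ = (X (J n).2 w - X (J n).1 w)%:E) ?ltry//.
    exact: path_measure_itv.
  + by rewrite /ocitv_of rhoE// ltry.
  + move=> x y; rewrite /ocitv_of.
    have -> : (`]x, y] `&` `](J n).1, (J n).2])%classic =
        ocitv_of (Num.max x (J n).1, Num.min y (J n).2).
      apply/seteqP; split => u; rewrite /ocitv_of/= !in_itv/= gt_max le_min.
        by move=> [/andP[-> ->] /andP[-> ->]].
      by move=> /andP[/andP[-> ->] /andP[-> ->]].
    apply: Hitv; rewrite gt_max !lt_min => /andP[/andP[xy xJ] /andP[Jy _]].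
    split; apply: (iT J1 J2); rewrite ?le_max ?ge_min lexx ?orbT//= ?andbT.
      by rewrite ge_max J12 ltW.
    by rewrite le_min J12 ltW.
  + exact: Hitv.
- by move=> w B mB; exact: path_measure_cover.
- exact: rhoJ.
Qed.

End poisson_mean_measure.

(** * Approximation by step functions *)

Section step_functions.
Context {R : realType} (T : set R).

(** Step functions are described by the partition that a finite set of points
    of T induces, not by a sum of indicators: two functions are then compatible
    with the union of their sets of points, which makes closure under pointwise
    operations immediate. The last two clauses are bounded support. *)
Definition step_fun (u : R -> R) := exists s : seq R,
  [/\ forall p, p \in s -> T p,
      forall x y, (forall p, p \in s -> (p < x) = (p < y)) -> u x = u y,
      forall x, (forall p, p \in s -> x <= p) -> u x = 0 &
      forall x, (forall p, p \in s -> p < x) -> u x = 0].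

Lemma step_fun_comp2 (phi : R -> R -> R) u v : phi 0 0 = 0 -> step_fun u -> step_fun v ->
  step_fun (fun x => phi (u x) (v x)).
Proof.
move=> phi0 [s [sT su sl sr]] [s' [sT' su' sl' sr']]; exists (s ++ s'); split.
- by move=> p; rewrite mem_cat => /orP[/sT|/sT'].
- by move=> x y xy; rewrite (su x y) 1?(su' x y)// => p ps;
    apply: xy; rewrite mem_cat ps ?orbT.
- by move=> x xp; rewrite sl ?sl'// => p ps; apply: xp; rewrite mem_cat ps ?orbT.
- by move=> x xp; rewrite sr ?sr'// => p ps; apply: xp; rewrite mem_cat ps ?orbT.
Qed.

Lemma step_fun_comp (phi : R -> R) u : phi 0 = 0 -> step_fun u -> step_fun (phi \o u).
Proof. by move=> phi0 su; exact: (@step_fun_comp2 (fun x _ => phi x) u u). Qed.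

Lemma step_fun0 : step_fun (fun=> 0).
Proof. by exists [::]; split. Qed.

Lemma step_fun_itv s t : T s -> T t -> step_fun (\1_(`]s, t]%classic : set R)).
Proof.
move=> Ts Tt; have [ts|st] := leP t s.
  rewrite (_ : \1__ = fun=> 0); first exact: step_fun0.
  by apply/funext => x; rewrite set_itv_ge ?indic0// bnd_simp -leNgt.
exists [:: s; t]; split.
- by move=> p; rewrite !inE => /orP[] /eqP ->.
- move=> x y xy; rewrite !indicE; congr (_ (nat_of_bool _)).
  apply/idP/idP; rewrite !inE/= !in_itv/= => /andP[sx xt].
    rewrite -(xy s) ?inE ?eqxx// sx/= leNgt -(xy t) ?inE ?eqxx ?orbT//.
    by rewrite -leNgt.
  by rewrite (xy s) ?inE ?eqxx// sx/= leNgt (xy t) ?inE ?eqxx ?orbT// -leNgt.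
- move=> x xp; rewrite indicE memNset//= in_itv/=.
  by rewrite ltNge xp ?inE ?eqxx.
- move=> x xp; rewrite indicE memNset//= in_itv/=.
  by move=> /andP[_]; rewrite leNgt xp// !inE eqxx orbT.
Qed.

Definition grid (p : nat) (t : nat -> R) :=
  (forall i, (i <= p)%N -> T (t i)) /\ (forall i, (i < p)%N -> t i < t i.+1).

Definition grid_fun (p : nat) (t : nat -> R) (a : nat -> R) (x : R) : R :=
  \sum_(i < p) a i * \1_(ocitv_of (t i, t i.+1)) x.

Lemma grid_lt p t : grid p t -> forall i j, (i < j)%N -> (j <= p)%N -> t i < t j.
Proof.
move=> [_ tS] i; elim => // j IH; rewrite ltnS leq_eqVlt => /orP[/eqP ->|ij] jp.
  exact: tS.
by rewrite (lt_trans (IH ij (ltnW jp)))// tS.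
Qed.

Lemma grid_funE p t a j x : grid p t -> (j < p)%N -> t j < x <= t j.+1 ->
  grid_fun p t a x = a j.
Proof.
move=> gt jp /andP[tx xt]; rewrite /grid_fun (bigD1 (Ordinal jp))//=.
rewrite indicE mem_set ?mulr1; last by rewrite /ocitv_of /= in_itv/= tx.
rewrite big1 ?addr0// => i ij; rewrite indicE memNset ?mulr0//.
rewrite /ocitv_of /= in_itv/= => /andP[tix xti].
have : nat_of_ord i != j by move: ij; rewrite -val_eqE.
rewrite neq_ltn => /orP[ltij|ltji].
  have : t i.+1 <= t j.
    move: ltij; rewrite leq_eqVlt => /orP[/eqP ->//|ltij].
    by rewrite ltW// (grid_lt gt)// ltnW.
  by rewrite leNgt (lt_le_trans tx).
have : t j.+1 <= t i.
  move: ltji; rewrite leq_eqVlt => /orP[/eqP ->//|ltji].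
  by rewrite ltW// (grid_lt gt)// ltnW.
by rewrite leNgt (lt_le_trans tix).
Qed.

Lemma grid_fun_comp p t a (phi : R -> R) : phi 0 = 0 -> grid p t ->
  phi \o grid_fun p t a =1 grid_fun p t (phi \o a).
Proof.
move=> phi0 gt x /=.
have [[j jp tx]|no] := pselect (exists2 j, (j < p)%N & t j < x <= t j.+1).
  by rewrite !(grid_funE _ gt jp tx).
have z b : grid_fun p t b x = 0.
  rewrite /grid_fun big1// => i _; rewrite indicE memNset ?mulr0//.
  by rewrite /ocitv_of/= in_itv/= => tx; apply: no; exists i.
by rewrite !z.
Qed.

(** Disjoint consecutive cells are what independence of increments requires. *)
Lemma step_fun_grid t0 u : T t0 -> step_fun u ->
  exists p t, grid p t /\ u =1 grid_fun p t (fun i => u (t i.+1)).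
Proof.
move=> Tt0 [s [sT su sl sr]].
pose s' := sort <=%R (undup s).
have ms' q : (q \in s') = (q \in s) by rewrite mem_sort mem_undup.
have ss' : sorted <%R s'.
  by rewrite lt_sorted_uniq_le sort_uniq undup_uniq sort_le_sorted.
pose t i := nth t0 s' i; pose p := (size s').-1.
have tlt i j : (i < j)%N -> (j < size s')%N -> t i < t j.
  by move=> ij js; rewrite /t (lt_sorted_ltn_nth t0 ss')// inE (ltn_trans ij).
have ti q : q \in s -> exists2 i, (i < size s')%N & q = t i.
  by rewrite -ms' => qs; exists (index q s'); rewrite ?index_mem// /t nth_index.
have gt : grid p t.
  split => i ip.
    have [e|s0] := posnP (size s').
      by rewrite /t nth_default// e.
    by apply: sT; rewrite -ms' /t mem_nth// (leq_ltn_trans ip)// /p prednK.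
  apply: tlt => //; move: ip; rewrite /p; lia.
exists p, t; split => // x.
have [[j js tj]|no] := pselect (exists2 j, (j < size s')%N & x <= t j).
  have exj : exists j, (j < size s')%N && (x <= t j) by exists j; rewrite js.
  case: (ex_minnP exj) => {tj js}j /andP[js xj] jmin.
  have ux : u x = u (t j).
    apply: su => q /ti[i il ->]; apply/idP/idP => [tix|tij].
      exact: lt_le_trans xj.
    rewrite ltNge; apply/negP => xi; move: tij; apply/negP; rewrite -leNgt.
    have /jmin : (i < size s')%N && (x <= t i) by rewrite il.
    by rewrite leq_eqVlt => /orP[/eqP ->//|/tlt/(_ il)/ltW].
  case: j js xj jmin ux => [|j] js xj jmin ux.
    rewrite sl; last first.
      move=> q /ti[[|i] il ->] //; exact: le_trans xj (ltW (tlt _ _ _ _)).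
    rewrite /grid_fun big1// => i _; rewrite indicE memNset ?mulr0//.
    rewrite /ocitv_of/= in_itv/= => /andP[+ _]; apply/negP; rewrite -leNgt.
    have [->//|i0] := posnP i.
    rewrite (le_trans xj)// ltW// tlt//; move: (ltn_ord i); rewrite /p; lia.
  rewrite (grid_funE (j := j) _ gt) ?ux//; first by rewrite /p; lia.
  rewrite xj andbT ltNge; apply/negP => xtj.
  have := jmin j; rewrite xtj andbT (ltnW js) => /(_ isT); lia.
have nox q : q \in s -> q < x.
  by move=> /ti[i il ->]; rewrite ltNge; apply/negP => xi; apply: no; exists i.
rewrite sr// /grid_fun big1// => i _; rewrite indicE memNset ?mulr0//.
rewrite /ocitv_of/= in_itv/= => /andP[_]; apply/negP; rewrite -ltNge nox//.
by rewrite -ms' /t mem_nth// -ltn_predRL; exact: ltn_ord.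
Qed.

End step_functions.

Section grid_integral.
Context {R : realType} (T : set R).
Local Open Scope ereal_scope.
Context (mu : {measure set (measurableTypeR R) -> \bar R}).

Lemma measurable_indic_ocitv (s : R * R) :
  measurable_fun setT (\1_(ocitv_of s) : R -> R).
Proof. by apply: measurable_indic; exact: measurable_ocitv_of. Qed.

Lemma measurable_grid_fun p t a : measurable_fun setT (@grid_fun R p t a).
Proof.
rewrite (_ : grid_fun _ _ _ = fun x => \sum_(i < p) a i * \1_(ocitv_of (t i, t i.+1)) x)%R//.
apply: measurable_sum => i; apply: measurable_funM => //.
exact: measurable_indic_ocitv.
Qed.

Lemma measurable_step_fun t0 u : T t0 -> step_fun T u -> measurable_fun setT u.
Proof.
move=> Tt0 /(step_fun_grid Tt0)[p [t [_ uE]]].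
by rewrite (funext uE); exact: measurable_grid_fun.
Qed.

Lemma integral_grid_fun p t a (r : nat -> R) :
  (forall i, (i < p)%N -> mu (ocitv_of (t i, t i.+1)) = (r i)%:E) ->
  mu.-integrable setT (EFin \o @grid_fun R p t a) /\
  \int[mu]_x (grid_fun p t a x)%:E = (\sum_(i < p) a i * r i)%:E.
Proof.
move=> tr.
have E : EFin \o grid_fun p t a =
    fun x => \sum_(i < p) (a i)%:E * (\1_(ocitv_of (t i, t i.+1)) x)%:E.
  by apply/funext => x; rewrite /grid_fun /= -sumEFin; apply: eq_bigr => i _; rewrite EFinM.
have I (i : 'I_p) : mu.-integrable setT (fun x => (\1_(ocitv_of (t i, t i.+1)) x)%:E).
  apply/integrableP; split.
    by apply/measurable_EFinP; exact: measurable_indic_ocitv.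
  under eq_integral do rewrite gee0_abs ?lee_fin//.
  rewrite integral_indic//; last exact: measurable_ocitv_of.
  by rewrite setIT tr// ltry.
split; first by rewrite E; apply: integrable_sum => // i _; exact: integrableZl.
rewrite (_ : \int[mu]_x _ = \int[mu]_x (EFin \o grid_fun p t a) x)// E.
rewrite integral_sum//; last by move=> i; exact: integrableZl.
rewrite -sumEFin; apply: eq_bigr => i _; rewrite integralZl// integral_indic//.
  by rewrite setIT tr.
exact: measurable_ocitv_of.
Qed.

End grid_integral.

Section step_density.
Context {R : realType} (T : set R) (t0 : R).
Context (rho : {measure set (measurableTypeR R) -> \bar R}) (J : nat -> R * R).
Hypothesis Tt0 : T t0.
Hypothesis iT : is_interval T.
Hypothesis JT : forall n, [/\ T (J n).1, T (J n).2 & (J n).1 <= (J n).2].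
Hypothesis rhofin : forall s t, T s -> T t -> (rho (ocitv_of (s, t)) < +oo)%E.
Hypothesis rhoJ : forall A, measurable A -> rho A = rho (A `&` \bigcup_n ocitv_of (J n)).
Local Open Scope ereal_scope.

(** Membership in the closure of step functions in L1(rho), for functions which
    may take infinite values. *)
Definition step_approximable (f : R -> \bar R) := forall eps : R, (0 < eps)%R ->
  exists u, step_fun T u /\ \int[rho]_x `|f x - (u x)%:E| <= eps%:E.

Lemma lee_dist_triangle (x y : \bar R) (u : R) :
  `|x - u%:E| <= `|x - y| + `|y - u%:E|.
Proof.
case: x y => [x||] [y||] //=; rewrite ?leey//.
by rewrite -EFinD lee_fin; exact: ler_distD.
Qed.

Lemma step_approximable_lim (f : R -> \bar R) : measurable_fun setT f ->
  (forall eps : R, (0 < eps)%R -> exists F : R -> \bar R,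
    [/\ measurable_fun setT F, \int[rho]_x `|f x - F x| <= eps%:E & step_approximable F]) ->
  step_approximable f.
Proof.
move=> mf H eps eps0; have e2 : (0 < eps / 2)%R by rewrite divr_gt0.
have [F [mF fF LF]] := H _ e2; have [u [su Fu]] := LF _ e2.
exists u; split => //.
have mu_ : measurable_fun setT (EFin \o u).
  by apply/measurable_EFinP; exact: (measurable_step_fun Tt0 su).
have m1 : measurable_fun setT (fun x => `|f x - F x|).
  by apply: measurableT_comp => //; exact: emeasurable_funB.
have m2 : measurable_fun setT (fun x => `|F x - (u x)%:E|).
  by apply: measurableT_comp => //; exact: emeasurable_funB.
rewrite (@le_trans _ _ (\int[rho]_x (`|f x - F x| + `|F x - (u x)%:E|)))//.
  apply: ge0_le_integral => //.
  - by apply: measurableT_comp => //; exact: emeasurable_funB.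
  - exact: emeasurable_funD.
  - by move=> x _; exact: lee_dist_triangle.
by rewrite ge0_integralD// [eps]splitr EFinD; exact: leeD.
Qed.

Lemma step_approximableD (f g : R -> \bar R) : measurable_fun setT f ->
  measurable_fun setT g -> (forall x, 0 <= f x) -> (forall x, 0 <= g x) ->
  step_approximable f -> step_approximable g -> step_approximable (fun x => f x + g x).
Proof.
move=> mf mg f0 g0 Lf Lg eps eps0; have e2 : (0 < eps / 2)%R by rewrite divr_gt0.
have [u [su fu]] := Lf _ e2; have [v [sv gv]] := Lg _ e2.
exists (fun x => (u x + v x)%R); split.
  by apply: (@step_fun_comp2 _ _ (fun x y => (x + y)%R)) => //; rewrite addr0.
have mu_ : measurable_fun setT (EFin \o u).
  by apply/measurable_EFinP; exact: (measurable_step_fun Tt0 su).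
have mv_ : measurable_fun setT (EFin \o v).
  by apply/measurable_EFinP; exact: (measurable_step_fun Tt0 sv).
have m1 : measurable_fun setT (fun x => `|f x - (u x)%:E|).
  by apply: measurableT_comp => //; exact: emeasurable_funB.
have m2 : measurable_fun setT (fun x => `|g x - (v x)%:E|).
  by apply: measurableT_comp => //; exact: emeasurable_funB.
rewrite (@le_trans _ _ (\int[rho]_x (`|f x - (u x)%:E| + `|g x - (v x)%:E|)))//.
  apply: ge0_le_integral => //.
  - apply: measurableT_comp => //; apply: emeasurable_funB; first exact: emeasurable_funD.
    by apply/measurable_EFinP; apply: measurable_funD; exact/measurable_EFinP.
  - exact: emeasurable_funD.
  - move=> x _; case: (f x) (g x) (f0 x) (g0 x) => [a||] [b||] //= _ _; rewrite ?leey//.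
    rewrite -EFinD lee_fin opprD addrACA; exact: ler_normD.
by rewrite ge0_integralD// [eps]splitr EFinD; exact: leeD.
Qed.

Lemma step_approximable_eq0 (f : R -> \bar R) : (forall x, f x = 0) -> step_approximable f.
Proof.
move=> f0 eps eps0; exists (fun=> 0%R); split; first exact: step_fun0.
by under eq_integral do rewrite f0 sube0 abse0; rewrite integral0 lee_fin ltW.
Qed.

Lemma step_approximableZ (r : R) (f : R -> \bar R) : measurable_fun setT f -> (0 <= r)%R ->
  step_approximable f -> step_approximable (fun x => r%:E * f x).
Proof.
move=> mf; rewrite le_eqVlt => /orP[/eqP <- _|r0 Lf eps eps0].
  by apply: step_approximable_eq0 => x; rewrite mul0e.
have [u [su fu]] := Lf _ (divr_gt0 eps0 r0).
exists (fun x => (r * u x)%R); split.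
  by apply: (@step_fun_comp _ _ (fun x => r * x)%R) => //; rewrite mulr0.
have mu_ : measurable_fun setT (EFin \o u).
  by apply/measurable_EFinP; exact: (measurable_step_fun Tt0 su).
rewrite (_ : \int[rho]_x _ = \int[rho]_x (r%:E * `|f x - (u x)%:E|)); last first.
  apply: eq_integral => x _; case: (f x) => [a||].
  - by rewrite -!EFinM -!EFinD /= -mulrBr normrM gtr0_norm.
  - by rewrite gt0_muley ?lte_fin//= gt0_muley ?lte_fin.
  - by rewrite gt0_muleNy ?lte_fin//= gt0_muley ?lte_fin.
rewrite ge0_integralZl//; last 2 first.
- by apply: measurableT_comp => //; exact: emeasurable_funB.
- by rewrite lee_fin ltW.
by rewrite -lee_pdivlMl// -EFinM mulrC.
Qed.

Lemma step_approximable_indic_sub (A : set R) : measurable A ->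
  (forall eps : R, (0 < eps)%R -> exists B,
    [/\ measurable B, B `<=` A, rho (A `\` B) <= eps%:E &
      step_approximable (fun x => (\1_B x)%:E)]) ->
  step_approximable (fun x => (\1_A x)%:E).
Proof.
move=> mA H; apply: step_approximable_lim; first exact/measurable_EFinP.
move=> eps /H[B [mB BA ABe LB]]; exists (fun x => (\1_B x)%:E); split => //.
  exact/measurable_EFinP.
rewrite (_ : \int[rho]_x _ = \int[rho]_x (\1_(A `\` B) x)%:E).
  by rewrite integral_indic ?setIT//; exact: measurableD.
apply: eq_integral => x _; rewrite !indicE -EFinD/=; congr EFin.
have [xB|xB] := boolP (x \in B).
  rewrite (mem_set (BA _ (set_mem xB))) subrr normr0 memNset//.
  by move=> [_]; apply; exact: set_mem.
rewrite subr0 ger0_norm//; congr (nat_of_bool _)%:R.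
by rewrite in_setD xB andbT.
Qed.

Lemma step_approximable_indic_bigsetU (G : nat -> set R) n : (forall k, measurable (G k)) ->
  trivIset setT G -> (forall k, step_approximable (fun x => (\1_(G k) x)%:E)) ->
  step_approximable (fun x => (\1_(\big[setU/set0]_(k < n) G k) x)%:E).
Proof.
move=> mG tG LG; elim: n => [|n IH].
  by rewrite big_ord0; apply: step_approximable_eq0 => x; rewrite indic0.
set U := \big[setU/set0]_(k < n) G k.
have mU : measurable U by exact: bigsetU_measurable.
rewrite big_ord_recr/= -/U.
rewrite (_ : (fun x => _) = fun x => (\1_U x)%:E + (\1_(G n) x)%:E).
  apply: step_approximableD => //; do ?exact/measurable_EFinP; by move=> x; rewrite lee_fin.
apply/funext => x; rewrite -EFinD !indicE in_setU; congr EFin.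
have [xU|_] := boolP (x \in U); last by rewrite add0r.
have [xG|_] := boolP (x \in G n); last by rewrite addr0.
exfalso; rewrite !inE in xU xG.
have tG' : trivIset (fun i => xpredT i) G by move=> i j _ _; exact: tG.
have := trivIset_bigsetUI tG' isT (leqnn n).
by move=> /seteqP[/(_ x (conj xU xG))].
Qed.

Lemma ecvg0_ex (v : nat -> \bar R) : v @ \oo --> 0 ->
  forall eps : R, (0 < eps)%R -> exists n, v n <= eps%:E.
Proof.
move=> /fine_cvgP[vfin /cvgrPdist_lt v0] eps eps0.
have [n _ /(_ n (leqnn n))[vn]] := filterI vfin (v0 _ eps0).
rewrite sub0r normrN => /(le_lt_trans (ler_norm _))/ltW vneps.
by exists n; rewrite -(fineK vn) lee_fin.
Qed.

Lemma step_approximable_indic_bigcup (G : nat -> set R) : (forall k, measurable (G k)) ->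
  trivIset setT G -> (forall k, step_approximable (fun x => (\1_(G k) x)%:E)) ->
  rho (\bigcup_k G k) < +oo -> step_approximable (fun x => (\1_(\bigcup_k G k) x)%:E).
Proof.
move=> mG tG LG fG.
have mA : measurable (\bigcup_k G k) by exact: bigcupT_measurable.
pose U n := \big[setU/set0]_(k < n) G k.
have mU n : measurable (U n) by exact: bigsetU_measurable.
have UA n : U n `<=` \bigcup_k G k.
  by rewrite /U -bigcup_mkord => x [k _ Gx]; exists k.
have cap0 : \bigcap_n (\bigcup_k G k `\` U n) = set0.
  rewrite -subset0 => x xA; have [[k _ Gx] _] := xA 0%N I.
  have [_] := xA k.+1 I; apply; rewrite /U big_ord_recr/=; by right.
have D0 : rho \o (fun n => \bigcup_k G k `\` U n) @ \oo --> 0.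
  rewrite -[X in _ --> X](measure0 rho) -cap0; apply: nonincreasing_cvg_mu.
  - by rewrite /U big_ord0 setD0.
  - by move=> n /=; apply: measurableD => //; exact: mU.
  - by rewrite cap0.
  - by move=> n k nk; apply/subsetPset; apply: setDS; exact: subset_bigsetU.
apply: step_approximable_indic_sub => // eps /(ecvg0_ex D0)[n ne].
by exists (U n); split => //; exact: step_approximable_indic_bigsetU.
Qed.

Lemma step_approximable_ocitv (s : R * R) : T s.1 -> T s.2 ->
  step_approximable (fun x => (\1_(ocitv_of s) x)%:E).
Proof.
move=> T1 T2 eps eps0; exists (\1_(ocitv_of s)); split; first exact: step_fun_itv.
under eq_integral do rewrite subee// abse0.
by rewrite integral0 lee_fin ltW.
Qed.

(** The sets whose trace on the interval J n has an approximable indicator form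
    a Dynkin class containing the intervals. *)
Lemma step_approximable_indic_local n (A : set (measurableTypeR R)) : measurable A ->
  step_approximable (fun x => (\1_(A `&` ocitv_of (J n)) x)%:E).
Proof.
move=> mA; have [J1 J2 J12] := JT n.
have mJ := measurable_ocitv_of (J n).
apply: (@dynkin_induction _ (measurableTypeR R) (@ocitv R)
  (fun A => step_approximable (fun x => (\1_(A `&` ocitv_of (J n)) x)%:E))) => //.
- exact: ocitvI.
- by rewrite setTI; exact: step_approximable_ocitv.
- move=> _ [[x y] _ <-].
  have -> : `]x, y]%classic `&` ocitv_of (J n) =
      ocitv_of (Num.max x (J n).1, Num.min y (J n).2).
    apply/seteqP; split => u; rewrite /ocitv_of/= !in_itv/= gt_max le_min.
      by move=> [/andP[-> ->] /andP[-> ->]].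
    by move=> /andP[/andP[-> ->] /andP[-> ->]].
  have [le|] := leP (Num.min y (J n).2) (Num.max x (J n).1).
    rewrite /ocitv_of set_itv_ge//=; last by rewrite bnd_simp -leNgt.
    by apply: step_approximable_eq0 => u; rewrite indic0.
  rewrite gt_max !lt_min => /andP[/andP[xy xJ] /andP[Jy _]].
  apply: step_approximable_ocitv => /=; apply: (iT J1 J2);
    rewrite ?le_max ?ge_min lexx ?orbT//= ?andbT.
    by rewrite ge_max J12 ltW.
  by rewrite le_min J12 ltW.
- move=> S mS LS eps eps0; have [u [su fu]] := LS _ eps0.
  exists (fun x => \1_(ocitv_of (J n)) x - u x)%R; split.
    apply: (@step_fun_comp2 _ _ (fun x y => (x - y)%R)) => //; first by rewrite subr0.
    exact: step_fun_itv.
  rewrite (le_trans _ fu)// le_eqVlt; apply/orP; left; apply/eqP.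
  apply: eq_integral => x _; rewrite -!EFinD/=; congr EFin.
  rewrite !indicE !in_setI in_setC; case: (x \in S) => /=.
    by rewrite sub0r normrN.
  by rewrite [in RHS]sub0r normrN; congr (`|_|)%R; ring.
- move=> F mF tF HF; rewrite setI_bigcupl; apply: step_approximable_indic_bigcup => //.
  + by move=> k /=; apply: measurableI; [exact: mF|exact: mJ].
  + exact: trivIset_setIr.
  + rewrite -setI_bigcupl (le_lt_trans _ (rhofin J1 J2))//.
    apply: le_measure; rewrite ?inE//.
    by apply: measurableI => //; exact: bigcupT_measurable.
Qed.

Lemma step_approximable_indic (A : set R) : measurable A -> rho A < +oo ->
  step_approximable (fun x => (\1_A x)%:E).
Proof.
move=> mA Afin.
pose D := seqDU (fun n => ocitv_of (J n)).
have mD n : measurable (D n).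
  apply: measurableD; first exact: measurable_ocitv_of.
  by apply: bigsetU_measurable => i _; exact: measurable_ocitv_of.
have UD : \bigcup_n ocitv_of (J n) = \bigcup_n D n by exact: seqDU_bigcup_eq.
have mUD : measurable (\bigcup_n D n) by exact: bigcupT_measurable.
apply: step_approximable_indic_sub => // eps eps0; exists (A `&` \bigcup_n D n); split => //.
- exact: measurableI.
- rewrite rhoJ; last by apply: measurableD => //; exact: measurableI.
  rewrite UD (_ : _ `&` _ = set0) ?measure0 ?lee_fin ?ltW//.
  by apply/seteqP; split => // x [[Ax nAU] Ux]; apply: nAU.
- rewrite setI_bigcupr; apply: step_approximable_indic_bigcup.
  + by move=> k /=; apply: measurableI; [exact: mA|exact: mD].
  + exact/trivIset_setIl/trivIset_seqDU.
  + move=> k; rewrite (_ : A `&` D k = (A `&` D k) `&` ocitv_of (J k)).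
      by apply: step_approximable_indic_local; apply: measurableI; [exact: mA|exact: mD].
    by apply/seteqP; split => [x [Ax [Jx nx]]|x [[Ax ?] _]].
  + rewrite -setI_bigcupr (le_lt_trans _ Afin)// le_measure ?inE//.
    exact: measurableI.
Qed.

(** Step functions are dense in the positive cone of L1(rho): indicators first,
    then increasing limits, by dominated convergence. *)
Lemma step_approximable_ge0 (f : R -> \bar R) : measurable_fun setT f ->
  (forall x, 0 <= f x) -> \int[rho]_x f x < +oo -> step_approximable f.
Proof.
move: f; apply: (@ge0_measurable_ind _ (measurableTypeR R) R
  (fun f => \int[rho]_x f x < +oo -> step_approximable f)).
- by move=> A mA; rewrite integral_indic ?setIT//; exact: step_approximable_indic.
- move=> r f r0 mf f0 IH; rewrite ge0_integralZl// => rf.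
  move: r0 rf; rewrite le_eqVlt => /orP[/eqP <-|r0] rf.
    by apply: step_approximable_eq0 => x; rewrite mul0e.
  apply: step_approximableZ => //; first exact: ltW.
  apply: IH; rewrite ltey; apply/eqP => fy; move: rf.
  by rewrite fy gt0_muley ?lte_fin// ltxx.
- move=> f g mf f0 mg g0 If Ig; rewrite ge0_integralD// => fg.
  have fg0 (h : R -> \bar R) : (forall x, 0 <= h x) -> 0 <= \int[rho]_x h x.
    by move=> h0; exact: integral_ge0.
  apply: step_approximableD => //; [apply: If|apply: Ig]; apply: le_lt_trans fg.
    by rewrite leeDl// fg0.
  by rewrite leeDr// fg0.
- move=> F mF F0 ndF IH; set f := fun x => limn (F ^~ x) => fin.
  have cF x : F ^~ x @ \oo --> f x.
    by have /ereal_nondecreasing_is_cvgn := ndF x.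
  have Ff n x : F n x <= f x.
    rewrite /f (cvg_lim _ (ereal_nondecreasing_cvgn (ndF x)))//.
    by apply: ereal_sup_ubound; exists n.
  have mf : measurable_fun setT f.
    exact: (emeasurable_fun_cvg F).
  have f0 x : 0 <= f x by rewrite (le_trans (F0 0%N x)).
  have intf : rho.-integrable setT f.
    apply/integrableP; split => //; rewrite (eq_integral f)// => x _.
    by rewrite gee0_abs.
  have Ffa x n : setT x -> `|F n x| <= f x by rewrite gee0_abs.
  have [_ dc _] := @dominated_convergence _ _ _ rho setT measurableT F f f mF mf
    (aeW _ (fun x _ => cF x)) intf
    (aeW _ Ffa).
  apply: step_approximable_lim => // eps eps0; have [n ne] := ecvg0_ex dc eps0.
  exists (F n); split; first exact: mF.
  + rewrite (le_trans _ ne)// le_eqVlt; apply/orP; left; apply/eqP.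
    apply: eq_integral => x _.
    by case: (f x) => [c||]; case: (F n x) => [b||] //=; rewrite distrC.
  + apply: IH; apply: le_lt_trans fin; exact: ge0_le_integral.
Qed.

End step_density.

Section clipped_step_approximation.
Context {R : realType} (T : set R) (t0 : R).
Context (rho : {measure set (measurableTypeR R) -> \bar R}) (J : nat -> R * R).
Hypothesis Tt0 : T t0.
Hypothesis iT : is_interval T.
Hypothesis JT : forall n, [/\ T (J n).1, T (J n).2 & (J n).1 <= (J n).2].
Hypothesis rhofin : forall s t, T s -> T t -> (rho (ocitv_of (s, t)) < +oo)%E.
Hypothesis rhoJ : forall A, measurable A -> rho A = rho (A `&` \bigcup_n ocitv_of (J n)).

Definition clip (M x : R) := Num.max (- M) (Num.min M x).

Lemma clip0 M : 0 <= M -> clip M 0 = 0.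
Proof. by move=> M0; rewrite /clip min_r// max_r// oppr_le0. Qed.

Lemma clip_le M x : 0 <= M -> `|clip M x| <= M.
Proof.
move=> M0; rewrite ler_norml /clip le_max lexx/= ge_max ge_min lexx andbT.
by rewrite ge0_cp.
Qed.

Lemma clip_dist M x y : `|clip M x - clip M y| <= `|x - y|.
Proof.
rewrite /clip; have [h1|h1] := leP M x; have [h2|h2] := leP M y;
  rewrite ?(min_l h1) ?(min_l h2) ?(min_r (ltW h1)) ?(min_r (ltW h2));
  do 2?[case: (leP (- M) _) => ?];
  rewrite ?subrr ?normr0//; do 2?[case: ler0P => ?]; lra.
Qed.

Lemma clip_abs M x : 0 <= M -> `|clip M x| <= `|x|.
Proof. by move=> M0; have := clip_dist M x 0; rewrite clip0// !subr0. Qed.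

Lemma clip_big M x : 0 <= M -> `|x - clip M x| <= if M < `|x| then `|x| else 0.
Proof.
move=> M0; rewrite /clip; case: ifPn => [Mx|].
  case: (leP M x) => h1; case: (leP (- M) _) => h2; move: Mx;
    do 2?[case: ler0P => ?]; lra.
rewrite -leNgt ler_norml => /andP[h1 h2].
by rewrite (min_idPr h2) (max_idPr h1) subrr normr0.
Qed.

Local Open Scope ereal_scope.

(** The positive and negative parts are approximated separately. *)
Lemma step_approx (g : R -> R) : measurable_fun setT g ->
  \int[rho]_x `|(g x)%:E| < +oo ->
  forall eps : R, (0 < eps)%R ->
  exists u, step_fun T u /\ \int[rho]_x `|(g x - u x)%:E| <= eps%:E.
Proof.
move=> mg ig eps eps0; have e2 : (0 < eps / 2)%R by rewrite divr_gt0.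
have part (s : R) : (`|s| = 1)%R -> exists u, step_fun T u /\
    \int[rho]_x `|(Num.max (s * g x) 0 - u x)%:E| <= (eps / 2)%:E.
  move=> s1; have mp : measurable_fun setT (fun x => Num.max (s * g x) 0)%R.
    by apply: measurable_maxr => //; exact: measurable_funM.
  apply: (step_approximable_ge0 Tt0 iT JT rhofin rhoJ (f := fun x => (Num.max (s * g x) 0)%:E)) => //.
  - exact/measurable_EFinP.
  - by move=> x; rewrite lee_fin le_max lexx orbT.
  - apply: le_lt_trans ig; apply: ge0_le_integral => //.
    + by move=> x _; rewrite lee_fin le_max lexx orbT.
    + exact/measurable_EFinP.
    + by apply: measurableT_comp => //; exact/measurable_EFinP.
    + move=> x _; rewrite /= lee_fin ge_max normr_ge0 andbT.
      by rewrite (le_trans (ler_norm _))// normrM s1 mul1r.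
have [u [su gu]] := part 1%R (normr1 _).
have [v [sv gv]] := part (-1)%R (normrN1 _).
exists (fun x => (u x - v x)%R); split.
  by apply: (@step_fun_comp2 _ _ (fun x y => (x - y)%R)) => //; rewrite subr0.
have mm (s : R) w : step_fun T w ->
    measurable_fun setT (fun x => `|(Num.max (s * g x) 0 - w x)%:E|).
  move=> /(measurable_step_fun Tt0) mw; apply: measurableT_comp => //.
  apply/measurable_EFinP; apply: measurable_funB => //.
  by apply: measurable_maxr => //; exact: measurable_funM.
rewrite (@le_trans _ _ (\int[rho]_x (`|(Num.max (1 * g x) 0 - u x)%:E| +
    `|(Num.max (-1 * g x) 0 - v x)%:E|)))//.
  apply: ge0_le_integral => //.
  - apply: measurableT_comp => //; apply/measurable_EFinP.
    by apply: measurable_funB => //; apply: measurable_funB; exact: (measurable_step_fun Tt0).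
  - by apply: emeasurable_funD; exact: mm.
  - move=> x _; rewrite -EFinD lee_fin mul1r mulN1r.
    rewrite (_ : g x - (u x - v x) = (Num.max (g x) 0 - u x) - (Num.max (- g x) 0 - v x))%R.
      exact: ler_normB.
    by case: (leP (g x) 0%R) => h; case: (leP (- g x)%R 0%R) => h'; lra.
rewrite ge0_integralD//; do ?exact: mm.
by rewrite [eps]splitr EFinD; exact: leeD.
Qed.

(** Clipping the approximation of g to [-M, M] keeps it a step function and, as
    clipping is 1-Lipschitz, adds to the error only the part of g above M. *)
Lemma clipped_step_approx (g : R -> R) (M eps : R) : measurable_fun setT g ->
  \int[rho]_x `|(g x)%:E| < +oo -> (0 < M)%R -> (0 < eps)%R ->
  exists u, [/\ step_fun T u, (forall x, `|u x| <= M)%R,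
    \int[rho]_x `|(g x - u x)%:E| <=
      \int[rho]_x (if M < `|g x| then `|g x| else 0)%R%:E + eps%:E &
    \int[rho]_x (u x ^+ 2)%:E <= \int[rho]_x (g x ^+ 2)%:E + 1].
Proof.
move=> mg ig M0 eps0; have M0' := ltW M0.
(* the second bound on the error is for u ^ 2 <= clip g ^ 2 + 2 M |g - v| *)
have [|v [sv gv]] := step_approx mg ig (eps := (Num.min eps (2 * M)^-1)%R).
  by rewrite lt_min eps0 invr_gt0 mulr_gt0.
have mv := measurable_step_fun Tt0 sv.
pose u x := clip M (v x).
have su : step_fun T u by apply: (@step_fun_comp _ _ (clip M)) => //; exact: clip0.
have mu_ := measurable_step_fun Tt0 su.
exists u; split => //.
- by move=> x; exact: clip_le.
- have mbig : measurable_fun setT (fun x => (if M < `|g x| then `|g x| else 0)%R%:E).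
    apply/measurable_EFinP; apply: measurable_fun_ifT => //.
      by apply: measurable_fun_ltr => //; exact: measurableT_comp.
    exact: measurableT_comp.
  have mgv : measurable_fun setT (fun x => `|(g x - v x)%:E|).
    apply: measurableT_comp => //; apply/measurable_EFinP; exact: measurable_funB.
  rewrite (@le_trans _ _ (\int[rho]_x ((if M < `|g x| then `|g x| else 0)%R%:E +
      `|(g x - v x)%:E|)))//.
    apply: ge0_le_integral => //.
    + apply: measurableT_comp => //; apply/measurable_EFinP; exact: measurable_funB.
    + exact: emeasurable_funD.
    + move=> x _; rewrite -EFinD lee_fin.
      rewrite (_ : g x - u x = (g x - clip M (g x)) + (clip M (g x) - clip M (v x)))%R;
        last by rewrite /u; ring.
      by rewrite (le_trans (ler_normD _ _))// lerD ?clip_big ?clip_dist.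
  rewrite ge0_integralD//; last by move=> x _; rewrite lee_fin; case: ifP.
  by rewrite leeD2l// (le_trans gv)// lee_fin ge_min lexx.
- rewrite (@le_trans _ _ (\int[rho]_x ((g x ^+ 2)%:E + (2 * M)%:E * `|(g x - v x)%:E|)))//.
    apply: ge0_le_integral => //.
    + by move=> x _; rewrite lee_fin sqr_ge0.
    + by apply/measurable_EFinP; exact: measurable_funX.
    + apply: emeasurable_funD; first by apply/measurable_EFinP; exact: measurable_funX.
      apply: measurable_funeM; apply: measurableT_comp => //.
      by apply/measurable_EFinP; exact: measurable_funB.
    + move=> x _; rewrite -EFinM -EFinD lee_fin.
      have h1 := clip_dist M (g x) (v x); have h2 := clip_abs (g x) M0'.
      have h3 := clip_le (v x) M0'; have h4 := clip_le (g x) M0'.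
      have : (clip M (g x) ^+ 2 <= g x ^+ 2)%R.
        by rewrite -[leLHS]real_normK ?num_real// -[leRHS]real_normK ?num_real// lerXn2r ?nnegrE.
      suff : (u x ^+ 2 - clip M (g x) ^+ 2 <= 2 * M * `|g x - v x|)%R by rewrite /u; lra.
      rewrite subr_sqr (le_trans (ler_norm _))// normrM mulrC ler_pM//.
        by rewrite (le_trans (ler_normD _ _))// mulr_natl mulr2n lerD.
      by rewrite distrC.
  rewrite ge0_integralD//; last 4 first.
  + by move=> x _; rewrite lee_fin sqr_ge0.
  + by apply/measurable_EFinP; exact: measurable_funX.
  + by move=> x _; rewrite mule_ge0// lee_fin mulr_ge0.
  + apply: measurable_funeM; apply: measurableT_comp => //.
    by apply/measurable_EFinP; exact: measurable_funB.
  rewrite leeD2l// ge0_integralZl//; last 2 first.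
  + apply: measurableT_comp => //; apply/measurable_EFinP; exact: measurable_funB.
  + by rewrite lee_fin mulr_ge0.
  rewrite -lee_pdivlMl ?mulr_gt0// mule1 (le_trans gv)// lee_fin ge_min lexx orbT//.
Qed.

End clipped_step_approximation.

(** * Exponential moments of step functions *)

Section independence.
Context {d} {Omega : measurableType d} {R : realType} (P : probability Omega R).
Local Open Scope ereal_scope.

(** The hypothesis is the product formula with V replaced by the indicator of
    any event {V in B}. Both sides of the conclusion, with h o V in place of V,
    are functionals of h to which [ge0_measurable_ind] applies. *)
Lemma product_expectation (V W : Omega -> R) : measurable_fun setT V ->
  measurable_fun setT W -> (forall w, 0 <= V w)%R -> (forall w, 0 <= W w)%R ->
  \int[P]_w (W w)%:E < +oo ->
  (forall B, measurable B ->
    \int[P]_w (\1_(V @^-1` B) w * W w)%:E =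
    P (V @^-1` B) * \int[P]_w (W w)%:E) ->
  \int[P]_w (V w * W w)%:E = \int[P]_w (V w)%:E * \int[P]_w (W w)%:E.
Proof.
move=> mV mW V0 W0; set c := \int[P]_w (W w)%:E => cfin H.
have c0 : 0 <= c by apply: integral_ge0 => w _; rewrite lee_fin.
have cfn : c \is a fin_num by rewrite ge0_fin_numE.
have mWE : measurable_fun setT (EFin \o W) by exact/measurable_EFinP.
have mhV (h : R -> \bar R) : measurable_fun setT h ->
    measurable_fun setT (fun w => h (V w)).
  by move=> mh; exact: (measurableT_comp mh).
have mhVW (h : R -> \bar R) : measurable_fun setT h ->
    measurable_fun setT (fun w => h (V w) * (W w)%:E).
  by move=> mh; apply: emeasurable_funM => //; exact: mhV.
have key : forall h : R -> \bar R, measurable_fun setT h -> (forall x, 0 <= h x) ->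
    \int[P]_w (h (V w) * (W w)%:E) = \int[P]_w h (V w) * c.
  apply: ge0_measurable_ind.
  - move=> A mA.
    have mVA : measurable (V @^-1` A) by rewrite -[X in measurable X]setTI; exact: mV.
    transitivity (\int[P]_w (\1_(V @^-1` A) w * W w)%:E).
      by apply: eq_integral => w _; rewrite EFinM.
    rewrite H//; congr (_ * _); rewrite -[RHS]/(\int[P]_w (\1_(V @^-1` A) w)%:E).
    by rewrite integral_indic// setIT.
  - move=> r h r0 mh h0 IH.
    rewrite (_ : \int[P]_w (r%:E * h (V w)) = r%:E * \int[P]_w h (V w)); last first.
      by rewrite ge0_integralZl//; exact: mhV.
    rewrite -muleA -IH -ge0_integralZl//; last 2 first.
    + exact: mhVW.
    + by move=> w _; rewrite mule_ge0// lee_fin.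
    by apply: eq_integral => w _; rewrite muleA.
  - move=> g h mg g0 mh h0 Ig Ih.
    rewrite (_ : \int[P]_w (g (V w) + h (V w)) = \int[P]_w g (V w) + \int[P]_w h (V w)); last first.
      by rewrite ge0_integralD//; exact: mhV.
    rewrite ge0_muleDl; try by apply: integral_ge0.
    rewrite -Ig -Ih -ge0_integralD//.
    + by apply: eq_integral => w _; rewrite ge0_muleDl.
    + by move=> w _; rewrite mule_ge0// lee_fin.
    + exact: mhVW.
    + by move=> w _; rewrite mule_ge0// lee_fin.
    + exact: mhVW.
  - move=> F mF F0 ndF IH.
    have E1 : \int[P]_w limn (F ^~ (V w)) = limn (fun n => \int[P]_w F n (V w)).
      by rewrite monotone_convergence// => n; exact: mhV.
    have E2 : \int[P]_w limn (fun n => F n (V w) * (W w)%:E) =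
        limn (fun n => \int[P]_w (F n (V w) * (W w)%:E)).
      rewrite monotone_convergence// => [n|n w _|w _ i j ij].
      + exact: mhVW.
      + by rewrite mule_ge0// lee_fin.
      + by rewrite lee_wpmul2r ?lee_fin//; exact: ndF.
    rewrite E1 -limeMr//; last first.
      apply: ereal_nondecreasing_is_cvgn => i j ij; apply: ge0_le_integral => //.
      + exact: mhV.
      + exact: mhV.
      + by move=> w _; exact: ndF.
    rewrite (_ : (fun n => \int[P]_w F n (V w) * c) =
        fun n => \int[P]_w (F n (V w) * (W w)%:E)); last by apply/funext => n; rewrite IH.
    rewrite -E2; apply: eq_integral => w _; rewrite limeMr//.
    by apply: ereal_nondecreasing_is_cvgn; exact: ndF.
have VE w : (V w)%:E = (Num.max (V w) 0)%:E by rewrite max_l.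
transitivity (\int[P]_w ((Num.max (V w) 0)%:E * (W w)%:E)).
  by apply: eq_integral => w _; rewrite -VE EFinM.
rewrite (key (fun x => (Num.max x 0)%:E)).
- by congr (_ * _); apply: eq_integral => w _; rewrite -VE.
- by apply/measurable_EFinP; exact: measurable_maxr.
- by move=> x; rewrite lee_fin le_max lexx orbT.
Qed.

Lemma measurable_of_preimage (V : Omega -> R) (G : set (set Omega)) :
  (forall E, G E -> measurable E) ->
  (forall B, measurable B -> G (V @^-1` B)) -> measurable_fun setT V.
Proof. by move=> GM VG _ B mB; rewrite setTI; apply: GM; exact: VG. Qed.

(** Independence is the product formula for indicators; the indicators are
    exchanged for the V i one index at a time. *)
Lemma independent_product_expectation (I : finType) (F : I -> set (set Omega))
    (V : I -> Omega -> R) : mutually_independent P F ->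
  (forall i E, F i E -> measurable E) ->
  (forall i B, measurable B -> F i (V i @^-1` B)) ->
  (forall i w, 0 <= V i w)%R ->
  (forall i, \int[P]_w (V i w)%:E < +oo) ->
  \int[P]_w (\prod_i V i w)%:E = (\prod_i fine (\int[P]_w (V i w)%:E))%:E.
Proof.
move=> indep FM VF V0 Vfin.
(* the factors with index in s are general, the other ones are indicators *)
suff H (s : seq I) : uniq s -> forall U : I -> Omega -> R,
    (forall i w, 0 <= U i w)%R -> (forall i, \int[P]_w (U i w)%:E < +oo) ->
    (forall i, i \in s -> forall B, measurable B -> F i (U i @^-1` B)) ->
    (forall i, i \notin s -> exists2 E, F i E & U i = \1_E) ->
    \int[P]_w (\prod_i U i w)%:E = (\prod_i fine (\int[P]_w (U i w)%:E))%:E.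
  apply: (H (enum I)) => //; first exact: enum_uniq.
    by move=> i _; exact: VF.
  by move=> i; rewrite mem_enum.
elim: s => [_|i0 s IH /= /andP[i0s us]] U U0 Ufin Us Uns.
  have /choice[E EP] i : exists E, F i E /\ U i = \1_E.
    by have [|E] := Uns i; [rewrite in_nil|exists E].
  have mE i : measurable (E i) by apply: FM; exact: (EP i).1.
  have mcap : measurable (\bigcap_(i in [set` [set: I]%SET]) E i).
    by apply: fin_bigcap_measurable => //; exact: finite_finset.
  have UE : \int[P]_w (\prod_i U i w)%:E = P (\bigcap_(i in [set` [set: I]%SET]) E i).
    transitivity (\int[P]_w (\1_(\bigcap_(i in [set` [set: I]%SET]) E i) w)%:E); last first.
      by rewrite integral_indic// setIT.
    apply: eq_integral => w _; congr EFin; rewrite indicE.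
    have [wE|] := boolP (w \in _).
      rewrite big1// => i _; rewrite (EP i).2 indicE mem_set//.
      by rewrite inE in wE; apply: wE; rewrite /= inE.
    rewrite notin_setE => /existsNP[i /not_implyP[_ nEi]].
    by rewrite (bigD1 i)//= (EP i).2 indicE memNset// mul0r.
  have PE : fine (P (\bigcap_(i in [set` [set: I]%SET]) E i)) = (\prod_i fine (P (E i)))%R.
    rewrite (indep [set: I]%SET E (fun i _ => (EP i).1)).
    by apply: eq_bigl => i; rewrite inE.
  rewrite UE -[LHS]fineK ?fin_num_measure// PE.
  congr EFin; apply: eq_bigr => i _; rewrite (EP i).2.
  by rewrite integral_indic// setIT.
have mU i : measurable_fun setT (U i).
  have [is_|nis] := boolP (i \in i0 :: s).
    by apply: (measurable_of_preimage (@FM i)); exact: Us.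
  by have [E FE ->] := Uns i nis; apply: measurable_indic; exact: FM FE.
pose W w := (\prod_(i | i != i0) U i w)%R.
have UB B : measurable B ->
    \int[P]_w (\1_(U i0 @^-1` B) w * W w)%:E =
    P (U i0 @^-1` B) * (\prod_(i | i != i0) fine (\int[P]_w (U i w)%:E))%:E.
  move=> mB.
  pose UB i := if i == i0 then \1_(U i0 @^-1` B) : Omega -> R else U i.
  have mUB : measurable (U i0 @^-1` B).
    by rewrite -[X in measurable X]setTI; exact: mU.
  have IUB : \int[P]_w (\1_(U i0 @^-1` B) w)%:E = P (U i0 @^-1` B).
    by rewrite integral_indic// setIT.
  have UB0 : UB i0 = \1_(U i0 @^-1` B) by rewrite /UB eqxx.
  have UBN i : i != i0 -> UB i = U i by rewrite /UB => /negbTE ->.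
  have := IH us UB; rewrite (bigD1 i0)//= UB0 IUB.
  rewrite (eq_bigr (fun i => fine (\int[P]_w (U i w)%:E))); last first.
    by move=> i ii0; rewrite UBN.
  rewrite EFinM fineK ?fin_num_measure// => <-.
  - apply: eq_integral => w _; rewrite (bigD1 i0)//= UB0; congr (_ * _)%:E.
    by apply: eq_bigr => i ii0; rewrite UBN.
  - move=> i w; have [->|ii0] := eqVneq i i0; last by rewrite UBN.
    by rewrite UB0.
  - move=> i; have [->|ii0] := eqVneq i i0; last by rewrite UBN.
    by rewrite UB0 IUB (le_lt_trans (probability_le1 P mUB))// ltry.
  - move=> i is_; rewrite UBN; first by apply: Us; rewrite inE is_ orbT.
    by apply: contraNneq i0s => <-.
  - move=> i; have [->|ii0 nis] := eqVneq i i0.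
      by move=> _; exists (U i0 @^-1` B) => //; apply: Us => //; rewrite mem_head.
    by rewrite UBN//; apply: Uns; rewrite inE negb_or ii0.
have IW : \int[P]_w (W w)%:E = (\prod_(i | i != i0) fine (\int[P]_w (U i w)%:E))%:E.
  have := UB setT measurableT; rewrite preimage_setT probability_setT mul1e => <-.
  by apply: eq_integral => w _; rewrite indicT mul1r.
rewrite (bigD1 i0)//= EFinM fineK; last first.
  by rewrite ge0_fin_numE//; apply: integral_ge0 => w _; rewrite lee_fin.
rewrite -IW -product_expectation//.
- by apply: eq_integral => w _; rewrite (bigD1 i0).
- rewrite (_ : W = fun w => \prod_(i <- index_enum I) (if i != i0 then U i w else 1))%R.
    by apply: measurable_prod => i _; case: (i != i0).
  by apply/funext => w; rewrite /W big_mkcond.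
- by move=> w; apply: prodr_ge0.
- by rewrite IW ltry.
- by move=> B mB; rewrite UB// IW.
Qed.

End independence.

Section exponential_moments.
Context {d} {Omega : measurableType d} {R : realType} (P : probability Omega R).
Context (T : set R) (l : R -> R).
Hypothesis iT : is_interval T.
Hypothesis hl : intensity_function T l.

Local Notation incr X t i := (fun w => X (t (nat_of_ord i).+1) w - X (t (nat_of_ord i)) w).

Lemma mgf_process (X : R -> Omega -> R) p t (th : nat -> R) :
  poisson_process P T l X -> (forall t, measurable_fun setT (X t)) -> grid T p t ->
  (\int[P]_w (expR (\sum_(i < p) th i * incr X t i w))%:E =
  (expR (\sum_(i < p) rate l (t i) (t i.+1) * (expR (th i) - 1)))%:E)%E.
Proof.
move=> pX mX [tT tlt].
pose V (i : 'I_p) w := expR (th i * incr X t i w).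
have VE (i : 'I_p) :
    (\int[P]_w (V i w)%:E = (expR (rate l (t i) (t i.+1) * (expR (th i) - 1)))%:E)%E.
  apply: (poisson_incr_mgf iT hl pX) => //; [apply: tT|apply: tT|apply: tlt] => //.
  exact: ltnW.
transitivity (\int[P]_w (\prod_i V i w)%:E)%E.
  by apply: eq_integral => w _; rewrite expR_sum.
rewrite (@independent_product_expectation _ _ _ _ _ (fun i : 'I_p =>
  preimage_set_system setT (incr X t i) measurable)).
- by rewrite expR_sum; congr EFin; apply: eq_bigr => i _; rewrite VE.
- by case: pX => _ + _; apply.
- by move=> i _ [B mB <-]; exact: measurable_incr.
- move=> i B mB; exists ((fun x => expR (th i * x)) @^-1` B); last by rewrite setTI.
  have mf : measurable_fun setT (fun x => expR (th i * x)).
    by apply: measurableT_comp => //; exact: measurable_funM.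
  by rewrite -[X in measurable X]setTI; exact: mf.
- by move=> i w; exact: expR_ge0.
- by move=> i; rewrite VE ltry.
Qed.

Lemma sigma_process_measurable (X : R -> Omega -> R) :
  (forall t, measurable_fun setT (X t)) ->
  forall E, sigma_process T X E -> measurable E.
Proof.
move=> mX; apply: smallest_sub; first exact: sigma_algebra_measurable.
by move=> _ [t _ [B mB <-]]; exact: mX.
Qed.

(** Measurability is checked on Omega equipped with the sigma-algebra generated
    by the process alone. *)
Lemma sigma_process_exp (X : R -> Omega -> R) p t (th : nat -> R) :
  grid T p t -> forall B, measurable B ->
  sigma_process T X ((fun w => expR (\sum_(i < p) th i * incr X t i w)) @^-1` B).
Proof.
move=> [tT _] B mB.
pose G := \bigcup_(t in T) preimage_set_system setT (X t) measurable.
have mX s : T s -> measurable_fun (setT : set (g_sigma_algebraType G)) (X s).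
  move=> Ts _ C mC; apply: sub_sigma_algebra; exists s => //; exists C => //.
suff : measurable_fun (setT : set (g_sigma_algebraType G))
    (fun w => expR (\sum_(i < p) th i * incr X t i w)).
  by move=> /(_ measurableT B mB); rewrite setTI.
apply: measurableT_comp => //.
apply: measurable_sum => i; apply: measurable_funM => //.
by apply: measurable_funB; apply: mX; apply: tT => //; exact: ltnW.
Qed.

Lemma mgf_sample n (X : 'I_n -> R -> Omega -> R) p t (th : nat -> R) :
  poisson_sample P T l X -> (forall j t, measurable_fun setT (X j t)) ->
  grid T p t ->
  (\int[P]_w (expR (\sum_j \sum_(i < p) th i * incr (X j) t i w))%:E =
  (expR (n%:R * \sum_(i < p) rate l (t i) (t i.+1) * (expR (th i) - 1)))%:E)%E.
Proof.
move=> [pX iX] mX gt.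
pose V j w := expR (\sum_(i < p) th i * incr (X j) t i w).
have VE j := mgf_process th (pX j) (mX j) gt.
transitivity (\int[P]_w (\prod_j V j w)%:E)%E.
  by apply: eq_integral => w _; rewrite expR_sum.
rewrite (independent_product_expectation iX).
- rewrite (eq_bigr (fun=> expR (\sum_(i < p) rate l (t i) (t i.+1) * (expR (th i) - 1)))).
    by rewrite prodr_const card_ord expRM_natl.
  by move=> j _; rewrite VE.
- by move=> j E; apply: sigma_process_measurable.
- by move=> j B mB; exact: sigma_process_exp.
- by move=> j w; exact: expR_ge0.
- by move=> j; rewrite VE ltry.
Qed.

(** From exp (- x) >= 1 - x, as (1 - x) (1 + x + 2 x^2) = 1 + x^2 (1 - 2 x). *)
Lemma expR_quadratic (x : R) : x <= 2^-1 -> expR x - 1 - x <= 2 * x ^+ 2.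
Proof.
move=> x2; have x1 : 0 < 1 - x by lra.
have : expR x <= (1 - x)^-1.
  rewrite -[x in expR x]opprK expRN lef_pV2 ?posrE ?expR_gt0//.
  exact: expR_ge1Dx.
have : (1 - x)^-1 <= 1 + x + 2 * x ^+ 2.
  rewrite -[_^-1]mul1r ler_pdivrMr//.
  have : 0 <= x ^+ 2 * (1 - 2 * x) by rewrite mulr_ge0 ?sqr_ge0//; lra.
  by rewrite expr2; nra.
by lra.
Qed.

(** The logarithm of the centred exponential moment is n sum_i rate_i (e^z_i - 1 - z_i)
    with z_i = s a_i, at most 2 n sum_i rate_i z_i^2. Taking s of either sign
    gives both tails. *)
Lemma chernoff_bound n (X : 'I_n -> R -> Omega -> R) p t (a : nat -> R) (s x : R) :
  poisson_sample P T l X -> (forall j t, measurable_fun setT (X j t)) ->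
  grid T p t -> (forall i : 'I_p, `|s * a i| <= 2^-1) ->
  (P [set w | (s * x <= s * \sum_j \sum_(i < p) a i * (incr (X j) t i w - rate l (t i) (t i.+1)))%R] <=
   (expR (2 * s ^+ 2 * n%:R * (\sum_(i < p) a i ^+ 2 * rate l (t i) (t i.+1)) - s * x))%:E)%E.
Proof.
move=> pX mX gt sa.
pose Z w := \sum_j \sum_(i < p) a i * (incr (X j) t i w - rate l (t i) (t i.+1)).
have mZ : measurable_fun setT Z.
  apply: measurable_sum => j; apply: measurable_sum => i.
  by apply: measurable_funM => //; apply: measurable_funB => //; exact: measurable_funB.
set A := [set w | _].
have mA : measurable A.
  rewrite -[X in measurable X]setTI.
  by apply: (measurable_fun_le (f := cst (s * x)) (g := fun w => s * Z w)) => //; exact: measurable_funM.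
pose K := n%:R * \sum_(i < p) s * a i * rate l (t i) (t i.+1).
pose Y w := expR (\sum_j \sum_(i < p) s * a i * incr (X j) t i w).
have YE w : expR (s * Z w - s * x) = expR (- (K + s * x)) * Y w.
  rewrite -expRD; congr expR.
  have -> : s * Z w = \sum_j \sum_(i < p) s * a i * incr (X j) t i w - K.
    have -> : K = \sum_(j < n) \sum_(i < p) s * a i * rate l (t i) (t i.+1).
      by rewrite sumr_const card_ord /K mulr_natl.
    rewrite /Z mulr_sumr -sumrB.
    apply: eq_bigr => j _; rewrite mulr_sumr -sumrB; apply: eq_bigr => i _.
    by ring.
  by ring.
have mY : measurable_fun setT Y.
  apply: measurableT_comp => //; apply: measurable_sum => j; apply: measurable_sum => i.
  by apply: measurable_funM => //; exact: measurable_funB.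
rewrite (@le_trans _ _ (\int[P]_w (expR (- (K + s * x)) * Y w)%:E)%E)//.
  rewrite -[X in P X]setIT -(integral_indic P measurableT mA).
  apply: ge0_le_integral => //.
  - by apply/measurable_EFinP; exact: measurable_indic.
  - by apply/measurable_EFinP; exact: measurable_funM.
  - move=> w _; rewrite lee_fin -YE indicE; case: (boolP (w \in A)) => [|_]; last exact: expR_ge0.
    by rewrite inE /A/= => sZ; rewrite (le_trans _ (expR_ge1Dx _))// lerDl subr_ge0.
under eq_integral do rewrite EFinM.
rewrite ge0_integralZl//; last 2 first.
- exact/measurable_EFinP.
- by move=> w _; rewrite lee_fin expR_ge0.
rewrite (mgf_sample (fun i => s * a i) pX mX gt) -EFinM -expRD lee_fin ler_expR.
suff : n%:R * (\sum_(i < p) rate l (t i) (t i.+1) * (expR (s * a i) - 1)) - K <=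
    2 * s ^+ 2 * n%:R * (\sum_(i < p) a i ^+ 2 * rate l (t i) (t i.+1)) by lra.
rewrite /K -mulrBr -sumrB (mulrC _ n%:R) -mulrA ler_wpM2l// mulr_sumr.
apply: ler_sum => i _.
have r0 : 0 <= rate l (t i) (t i.+1).
  by apply: (rate_ge0 iT hl); apply: gt.1 => //; exact: ltnW.
have := ler_wpM2r r0 (expR_quadratic (le_trans (ler_norm _) (sa i))).
lra.
Qed.

End exponential_moments.

(** * Tail of the empirical moment *)

Section integral_distance.
Context {d} {X : measurableType d} {R : realType} (mu : {measure set X -> \bar R}).
Local Open Scope ereal_scope.

(** If the right-hand side is infinite the bound is trivial, and otherwise h is
    integrable as u is. *)
Lemma dist_integral_le (h u : X -> R) : measurable_fun setT h ->
  mu.-integrable setT (EFin \o u) ->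
  (`| fine (\int[mu]_x (h x)%:E) - fine (\int[mu]_x (u x)%:E) |)%R%:E <=
  \int[mu]_x `|(h x - u x)%:E|.
Proof.
move=> mh iu; have mu_ : measurable_fun setT u.
  by apply/measurable_EFinP; exact: measurable_int iu.
have [fin|] := ltP (\int[mu]_x `|(h x - u x)%:E|) +oo; last exact: le_trans (leey _).
have ihu : mu.-integrable setT (fun x => (h x - u x)%:E).
  by apply/integrableP; split => //; apply/measurable_EFinP; exact: measurable_funB.
have ih : mu.-integrable setT (EFin \o h).
  apply: (eq_integrable _ (fun x => (h x - u x)%:E + (u x)%:E)) => //.
    by move=> x _; rewrite /= -EFinD subrK.
  exact: integrableD.
have -> : (fine (\int[mu]_x (h x)%:E) - fine (\int[mu]_x (u x)%:E))%R =
    fine (\int[mu]_x (h x - u x)%:E).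
  rewrite (_ : \int[mu]_x (h x - u x)%:E = \int[mu]_x (h x)%:E - \int[mu]_x (u x)%:E).
    exact: (esym (fineB (integrable_fin_num measurableT ih)
      (integrable_fin_num measurableT iu))).
  by rewrite -integralB_EFin.
rewrite -abse_EFin fineK; last exact: (integrable_fin_num measurableT ihu).
by apply: le_abse_integral => //; apply/measurable_EFinP; exact: measurable_funB.
Qed.

Lemma markov_ge0 (P : probability X R) (f : X -> \bar R) (x : R) (c : R) :
  measurable_fun setT f -> (forall w, 0 <= f w) -> (0 < x)%R ->
  \int[P]_w f w <= c%:E -> P [set w | x%:E <= f w] <= (c / x)%:E.
Proof.
move=> mf f0 x0 fc; set A := [set w | _].
have mA : measurable A.
  rewrite -[X in measurable X]setTI.
  by apply: emeasurable_fun_c_infty.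
rewrite mulrC EFinM lee_pdivlMl//.
apply: le_trans fc; rewrite -[X in P X]setIT -(integral_indic P measurableT mA).
rewrite -ge0_integralZl//; last 2 first.
- by apply/measurable_EFinP; exact: measurable_indic.
- by rewrite lee_fin ltW.
apply: ge0_le_integral => //.
- by move=> w _; rewrite mule_ge0// lee_fin// ltW.
- by apply/measurable_EFinP; apply: measurable_funM => //; exact: measurable_indic.
- move=> w _; rewrite indicE; case: (boolP (w \in A)) => [|_]; last by rewrite mule0.
  by rewrite inE mule1.
Qed.

End integral_distance.

Section empirical_moment_tail.
Context {d} {Omega : measurableType d} {R : realType} (P : probability Omega R).
Context (T : set R) (l g : R -> R) (t0 : R) (n : nat) (X : 'I_n -> R -> Omega -> R).
Hypothesis iT : is_interval T.
Hypothesis hl : intensity_function T l.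
Hypothesis mg : measurable_fun T g.
Hypothesis Tt0 : T t0.
Hypothesis n0 : (0 < n)%N.
Hypothesis mX : forall j t, measurable_fun setT (X j t).
Hypothesis pX : poisson_sample P T l X.
Local Notation leb := (@lebesgue_measure R).

Let mT : measurable T. Proof. exact: is_interval_measurable. Qed.

Let h := g \_ T.

Let mh : measurable_fun setT h.
Proof. exact: (measurable_restrictT g mT).1. Qed.

Let N j w : {measure set (measurableTypeR R) -> \bar R} := path_measure T (X j ^~ w).

Lemma empirical_momentE w : empirical_moment T g X w =
  n%:R^-1 * \sum_(j < n) fine (\int[N j w]_x (h x)%:E).
Proof.
rewrite /empirical_moment; congr (_ * _); apply: eq_bigr => j _.
by rewrite Rintegral_mkcond.
Qed.

Lemma measurable_empirical_moment : measurable_fun setT (empirical_moment T g X).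
Proof.
have [rho [J [JT JP rhoE rhoJ _]]] := intensity_measure iT hl Tt0.
rewrite (_ : empirical_moment T g X = fun w =>
  n%:R^-1 * \sum_(j < n) fine (\int[N j w]_x (h x)%:E)); last first.
  by apply/funext => w; exact: empirical_momentE.
apply: measurable_funM => //; apply: measurable_sum => j.
apply: measurableT_comp => //.
have mN (f : R -> \bar R) : measurable_fun setT f -> (forall x, 0 <= f x)%E ->
    measurable_fun setT (fun w => \int[N j w]_x f x)%E.
  move=> mf f0; apply: measurable_fun_integral_kernel => // A mA.
  exact: (poisson_has_mean iT hl (pX.1 j) (mX j) JT JP rhoE rhoJ mA).1.
rewrite (_ : (fun w => _) = fun w =>
  (\int[N j w]_x ((EFin \o h)^\+ x) - \int[N j w]_x ((EFin \o h)^\- x))%E); last first.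
  by apply/funext => w; rewrite integralE.
have mhE : measurable_fun setT (EFin \o h) by exact/measurable_EFinP.
by apply: emeasurable_funB; apply: mN => //;
  [exact: measurable_funepos|exact: measurable_funeneg].
Qed.

Context (k2 e : R).
Hypothesis int_g : (\int[leb]_(x in T) (`|g x| * l x)%:E < +oo)%E.
Hypothesis int_g2 : (\int[leb]_(x in T) (g x ^+ 2 * l x)%:E <= k2%:E)%E.
Hypothesis int_tail :
  (\int[leb]_(x in T) ((if Num.sqrt n%:R < `|g x| then `|g x| else 0) * l x)%:E < e%:E)%E.

(** With u a step function close to g, the centred sum of the integrals of g
    differs from that of u by at most the sum of the path integrals of |g - u|,
    plus n e for the difference of the means; Markov's inequality bounds this
    error, and [chernoff_bound] the deviation of u. *)
Lemma empirical_moment_tail (y : R) : 0 < y ->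
  (P [set w | (y <= Num.sqrt n%:R * `|empirical_moment T g X w - \int[leb]_(x in T) (g x * l x)|)%R]
    <= (2 * expR ((k2 + 1) / 2 - y / 4) + 4 * Num.sqrt n%:R * e / y)%:E)%E.
Proof.
move=> y0.
have [rho [J [JT JP rhoE rhoJ rhoI]]] := intensity_measure iT hl Tt0.
have rhofin s t : T s -> T t -> (rho (ocitv_of (s, t)) < +oo)%E.
  by move=> Ts Tt; rewrite rhoE// ltry.
have rhoh (phi : R -> R) : measurable_fun setT phi -> (forall x, 0 <= phi x) ->
    (\int[rho]_x (phi (h x))%:E = \int[leb]_(x in T) (phi (g x) * l x)%:E)%E.
  move=> mphi phi0; rewrite (rhoI (fun x => (phi (h x))%:E)).
  - by apply: eq_integral => x; rewrite inE => Tx; rewrite EFinM /h patchE mem_set.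
  - by apply/measurable_EFinP; exact: (measurableT_comp mphi mh).
  - by move=> x; rewrite lee_fin.
have sn0 : 0 < Num.sqrt n%:R :> R by rewrite sqrtr_gt0 ltr0n.
have ih : (\int[rho]_x `|(h x)%:E| < +oo)%E.
  rewrite (_ : \int[rho]_x _ = \int[rho]_x (`|h x|)%:E)%E//.
  by rewrite (rhoh (fun x => `|x|)).
have tail := int_tail; set I1 := (\int[leb]_(x in T) _)%E in tail.
have tail0 : (0 <= I1)%E.
  apply: integral_ge0 => x Tx; rewrite lee_fin mulr_ge0//; first by case: ifP.
  by case: hl => + _ _; apply.
have I1fin : I1 \is a fin_num by rewrite ge0_fin_numE// (lt_trans tail) ?ltry.
have eps0 : 0 < e - fine I1 by rewrite subr_gt0 -lte_fin fineK.
have [u [su uM hu u2]] := clipped_step_approx Tt0 iT JT rhofin rhoJ mh ih sn0 eps0.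
have {}hu : (\int[rho]_x `|(h x - u x)%:E| <= e%:E)%E.
  apply: le_trans hu _; rewrite (rhoh (fun z => if Num.sqrt n%:R < `|z| then `|z| else 0)).
  - by rewrite -/I1 -(fineK I1fin) -EFinD lee_fin; lra.
  - apply: measurable_fun_ifT => //.
    by apply: measurable_fun_ltr => //; exact: normr_measurable.
  - by move=> x; case: ifP.
have [p [t [gt uE]]] := step_fun_grid Tt0 su.
pose a i := u (t i.+1); pose r i := rate l (t i) (t i.+1).
have tT i : (i <= p)%N -> T (t i) by exact: gt.1.
have r0 (i : 'I_p) : 0 <= r i by apply: (rate_ge0 iT hl); apply: tT => //; exact: ltnW.
have rhot i : (i < p)%N -> rho (ocitv_of (t i, t i.+1)) = (r i)%:E.
  by move=> ip; rewrite rhoE//; apply: tT => //; exact: ltnW.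
have uE' : u = grid_fun p t a by exact/funext.
have mu_ : measurable_fun setT u by exact: (measurable_step_fun Tt0 su).
have [iu Iu] := integral_grid_fun a rhot; rewrite -uE' in iu Iu.
have kappa : \sum_(i < p) a i ^+ 2 * r i <= k2 + 1.
  have [_ Iu2] := integral_grid_fun (fun i => a i ^+ 2) rhot.
  rewrite -lee_fin -Iu2.
  rewrite (_ : \int[rho]_x _ = \int[rho]_x (u x ^+ 2)%:E)%E; last first.
    apply: eq_integral => x _; congr EFin; rewrite uE'.
    by rewrite -[RHS]/(((fun z => z ^+ 2) \o grid_fun p t a) x) (grid_fun_comp _ _ gt)// expr0n.
  apply: le_trans u2 _; rewrite EFinD leeD2r//.
  by rewrite (rhoh (fun z => z ^+ 2))// => z; exact: sqr_ge0.
pose m := \int[leb]_(x in T) (g x * l x).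
pose mu := \sum_(i < p) a i * r i.
(* the integral against rho is known for nonnegative functions only, whence the
   split into positive and negative parts *)
have mE : m = fine (\int[rho]_x (h x)%:E).
  rewrite /m /Rintegral; congr fine; rewrite integralE [RHS]integralE.
  have part (s : R) : (\int[rho]_x (Num.max (s * h x) 0)%:E =
      \int[leb]_(x in T) (Num.max (s * (g x * l x)) 0)%:E)%E.
    rewrite (rhoh (fun z => Num.max (s * z) 0)); last 2 first.
    - by apply: measurable_maxr => //; exact: measurable_funM.
    - by move=> z; rewrite le_max lexx orbT.
    apply: eq_integral => x; rewrite inE => Tx; congr EFin.
    have l0 : 0 <= l x by case: hl => + _ _; apply.
    by rewrite maxr_pMl// mul0r mulrA.
  have p1 := part 1; have p2 := part (-1).
  congr (_ - _)%E.
  - transitivity (\int[leb]_(x in T) (Num.max (1 * (g x * l x)) 0)%:E)%E.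
      by apply: eq_integral => x _; rewrite mul1r funeposE EFin_max.
    rewrite -p1; apply: eq_integral => x _; rewrite mul1r funeposE EFin_max//.
  - transitivity (\int[leb]_(x in T) (Num.max (-1 * (g x * l x)) 0)%:E)%E.
      by apply: eq_integral => x _; rewrite mulN1r funenegE EFin_max.
    rewrite -p2; apply: eq_integral => x _; rewrite mulN1r funenegE EFin_max//.
have mmu : `|m - mu| <= e.
  rewrite -lee_fin (le_trans _ hu)// mE (_ : mu = fine (\int[rho]_x (u x)%:E)).
    exact: dist_integral_le.
  by rewrite Iu.
pose Y j w := fine (\int[N j w]_x (h x)%:E).
pose U j w := \sum_(i < p) a i * (X j (t i.+1) w - X j (t i) w).
pose D w := (\sum_(j < n) \int[N j w]_x `|(h x - u x)%:E|)%E.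
have YU j w : ((`|Y j w - U j w|)%:E <= \int[N j w]_x `|(h x - u x)%:E|)%E.
  have Nt i : (i < p)%N -> N j w (ocitv_of (t i, t i.+1)) =
      (X j (t i.+1) w - X j (t i) w)%:E.
    move=> ip; apply: path_measure_itv => //; first by case: (pX.1 j).
    - exact/tT/ltnW.
    - exact: tT.
    - exact/ltW/gt.2.
  have [iuN IuN] := integral_grid_fun a (r := fun i => X j (t i.+1) w - X j (t i) w) Nt.
  rewrite -uE' in iuN IuN.
  rewrite (_ : U j w = fine (\int[N j w]_x (u x)%:E)); last by rewrite IuN.
  exact: dist_integral_le.
have mhu : measurable_fun setT (fun x => `|(h x - u x)%:E|)%E.
  by apply: measurableT_comp => //; apply/measurable_EFinP; exact: measurable_funB.
have Hmean j := poisson_has_mean iT hl (pX.1 j) (mX j) JT JP rhoE rhoJ.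
have mND j : measurable_fun setT (fun w => \int[N j w]_x `|(h x - u x)%:E|)%E.
  by apply: measurable_fun_integral_kernel => // A mA; exact: (Hmean j A mA).1.
have mD : measurable_fun setT D by apply: emeasurable_sum => j.
have D0 w : (0 <= D w)%E by apply: sume_ge0 => j _; exact: integral_ge0.
have e0 : 0 <= e by rewrite (le_trans _ mmu).
have ED : (\int[P]_w (D w + (n%:R * e)%:E) <= (n%:R * e *+ 2)%:E)%E.
  rewrite ge0_integralD//; last by move=> w _; rewrite lee_fin mulr_ge0.
  have -> : (\int[P]_w (n%:R * e)%:E = (n%:R * e)%:E)%E.
    transitivity ((n%:R * e)%:E * P setT)%E; first exact: integral_cst.
    by rewrite probability_setT mule1.
  rewrite mulr2n EFinD leeD2r//.
  rewrite ge0_integral_sum//; last by move=> j w _; exact: integral_ge0.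
  rewrite (_ : (n%:R * e)%:E = \sum_(j < n) e%:E)%E; last first.
    by rewrite sumEFin sumr_const card_ord mulr_natl.
  apply: lee_sum => j _; apply: le_trans hu.
  by rewrite (campbell (Hmean j) (h := fun x => `|(h x - u x)%:E|)%E).
pose x := Num.sqrt n%:R * y / 2.
have x0 : 0 < x by rewrite divr_gt0// mulr_gt0.
pose Z w := \sum_j \sum_(i < p) a i * (X j (t i.+1) w - X j (t i) w - r i).
(* |u| <= sqrt n makes s |u| <= 1/2, as [chernoff_bound] requires *)
pose s := (2 * Num.sqrt n%:R)^-1 : R.
have s0 : 0 < s by rewrite invr_gt0 mulr_gt0.
have snn : Num.sqrt n%:R * Num.sqrt n%:R = n%:R :> R.
  by rewrite -expr2 sqr_sqrtr.
have sa (c : R) : `|c| = 1 -> forall i : 'I_p, `|c * s * a i| <= 2^-1.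
  move=> c1 i; rewrite !normrM c1 mul1r gtr0_norm// /s invfM -mulrA ler_piMr//.
  by rewrite mulrC ler_pdivrMr// mul1r; exact: uM.
have chern (c : R) : `|c| = 1 ->
    (P [set w | (c * s * (c * x) <= c * s * Z w)%R] <= (expR ((k2 + 1) / 2 - y / 4))%:E)%E.
  move=> c1; have c2 : c * c = 1 by rewrite -expr2 -real_normK ?num_real// c1 expr1n.
  apply: le_trans (chernoff_bound iT hl (c * x) pX mX gt (sa c c1)) _.
  rewrite lee_fin ler_expR; have -> : c * s * (c * x) = y / 4.
    rewrite (_ : c * s * (c * x) = (c * c) * (s * x)); last by ring.
    by rewrite c2 mul1r /s /x; field; rewrite gt_eqF.
  rewrite lerD2r (_ : 2 * (c * s) ^+ 2 * n%:R = 2^-1).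
    by rewrite mulrC ler_wpM2r.
  rewrite exprMn expr2 c2 mul1r -snn /s; field; rewrite gt_eqF//.
have mZ : measurable_fun setT Z.
  apply: measurable_sum => j; apply: measurable_sum => i.
  by apply: measurable_funM => //; apply: measurable_funB => //; exact: measurable_funB.
pose A0 := [set w | (x%:E <= D w + (n%:R * e)%:E)%E].
pose A1 := [set w | 1 * s * (1 * x) <= 1 * s * Z w].
pose A2 := [set w | -1 * s * (-1 * x) <= -1 * s * Z w].
set E := [set w | _].
have mset (f f' : Omega -> R) : measurable_fun setT f -> measurable_fun setT f' ->
    measurable [set w | f w <= f' w].
  move=> mf mf'; rewrite -[X in measurable X]setTI.
  exact: measurable_fun_le.
have mE' : measurable E.
  apply: mset => //; apply: measurable_funM => //; apply: measurableT_comp => //.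
  by apply: measurable_funB => //; exact: measurable_empirical_moment.
have mW : measurable_fun setT (fun w => (D w + (n%:R * e)%:E)%E) by exact: emeasurable_funD.
have mA0 : measurable A0.
  by rewrite -[X in measurable X]setTI; exact: emeasurable_fun_c_infty.
have mA1 : measurable A1 by apply: mset => //; exact: measurable_funM.
have mA2 : measurable A2 by apply: mset => //; exact: measurable_funM.
have EA : E `<=` A0 `|` (A1 `|` A2).
  move=> w Ew; have [wA0|Wx] := leP x%:E (D w + (n%:R * e)%:E)%E; first by left.
  right.
  have sumYU : \sum_(j < n) `|Y j w - U j w| + n%:R * e < x.
    rewrite -lte_fin (le_lt_trans _ Wx)// EFinD leeD2r// -sumEFin.
    by apply: lee_sum => j _; exact: YU.
  have nn0 : n%:R != 0 :> R by rewrite pnatr_eq0 -lt0n.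
  have key : Num.sqrt n%:R * y <= `|\sum_(j < n) Y j w - n%:R * m|.
    have -> : \sum_(j < n) Y j w - n%:R * m =
        n%:R * (empirical_moment T g X w - m).
      by rewrite empirical_momentE mulrBr mulrA divff// mul1r.
    rewrite normrM normr_nat -[X in _ <= X * _]snn -mulrA ler_wpM2l//.
  have ZE : \sum_(j < n) Y j w - n%:R * m =
      Z w + (\sum_(j < n) (Y j w - U j w) + n%:R * (mu - m)).
    rewrite (_ : Z w = \sum_(j < n) U j w - n%:R * mu).
      by rewrite sumrB; ring.
    have -> : n%:R * mu = \sum_(j < n) mu by rewrite sumr_const card_ord mulr_natl.
    rewrite -sumrB.
    apply: eq_bigr => j _; rewrite /U /mu -sumrB; apply: eq_bigr => i _.
    by rewrite mulrBr.
  have : x <= `|Z w|.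
    have := ler_norm_sum (index_enum 'I_n) (fun j => Y j w - U j w) xpredT.
    have : n%:R * `|mu - m| <= n%:R * e by rewrite ler_wpM2l// distrC.
    have := ler_normD (Z w) (\sum_(j < n) (Y j w - U j w) + n%:R * (mu - m)).
    rewrite -ZE.
    have := ler_normD (\sum_(j < n) (Y j w - U j w)) (n%:R * (mu - m)).
    rewrite normrM normr_nat; move: key sumYU; rewrite /x; lra.
  rewrite ler_normr => /orP[xZ|xZ]; [left|right]; rewrite /A1 /A2/=.
    by rewrite !mul1r ler_wpM2l// ltW.
  have := ler_wpM2l (ltW s0) xZ; lra.
have PE : (P E <= P A0 + (P A1 + P A2))%E.
  rewrite (le_trans (le_measure P _ _ EA)) ?inE//; first by do 2?apply: measurableU.
  rewrite (le_trans (measureU2 P _ _))//; first exact: measurableU.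
  by rewrite leeD2l// measureU2.
apply: (le_trans PE); rewrite EFinD [leLHS]addeC.
apply: leeD.
  rewrite mulr_natl mulr2n EFinD; apply: leeD.
    by apply: (chern 1); exact: normr1.
  by apply: (chern (-1)); exact: normrN1.
apply: le_trans (markov_ge0 mW _ x0 ED) _.
  by move=> w; rewrite adde_ge0// lee_fin mulr_ge0.
rewrite lee_fin /x; move: snn sn0; set q := Num.sqrt n%:R => snn q0.
rewrite -snn le_eqVlt; apply/orP; left; apply/eqP; field.
by rewrite !gt_eqF.
Qed.

End empirical_moment_tail.

Section polynomial_decay.
Context {R : realType}.

(** This gamma solves (k + 1) (gamma - 1/2) = - k/2 - 1/4, the order required of
    the remainder when |eta| <= n^gamma. *)
Definition threshold_exponent (k : nat) : R := (4 * k.+1)%:R^-1.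

Lemma threshold_exponent_ge0 k : 0 <= threshold_exponent k.
Proof. by rewrite invr_ge0. Qed.

Lemma threshold_exponent_le k : threshold_exponent k <= 2^-1.
Proof. by rewrite lef_pV2 ?posrE// ler_nat; lia. Qed.

Lemma powR_threshold_exponent k (n : nat) : (n%:R `^ threshold_exponent k) ^+ (4 * k.+1) = n%:R :> R.
Proof. by rewrite -powR_mulrn ?powR_ge0// -powRrM mulVf ?pnatr_eq0// powRr1. Qed.

Lemma powR_ge1 (n : nat) (x : R) : (0 < n)%N -> 0 <= x -> 1 <= n%:R `^ x.
Proof.
by move=> n0 x0; rewrite -[leLHS](powRr0 n%:R) ler_powR// ler1n.
Qed.

Lemma sqrt_ge_powR_threshold k (n : nat) : (0 < n)%N -> n%:R `^ threshold_exponent k <= Num.sqrt n%:R :> R.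
Proof. by move=> n0; rewrite -powR12_sqrt// ler_powR ?ler1n// threshold_exponent_le. Qed.

(** From exp z = exp (z / N) ^ N >= (z / N) ^ N. *)
Lemma expRN_le_pow (N : nat) (z : R) : (0 < N)%N -> 0 < z ->
  expR (- z) <= (N%:R / z) ^+ N.
Proof.
move=> N0 z0; have N0' : 0 < N%:R :> R by rewrite ltr0n.
have zN0 : 0 < z / N%:R by rewrite divr_gt0.
have -> : z = N%:R * (z / N%:R) by rewrite mulrCA divff ?gt_eqF// mulr1.
rewrite expRN expRM_natl.
have -> : N%:R / (N%:R * (z / N%:R)) = (z / N%:R)^-1 by rewrite invfM mulrA divff ?gt_eqF// mul1r.
rewrite exprVn lef_pV2 ?posrE ?exprn_gt0 ?expR_gt0//.
apply: lerXn2r; rewrite ?nnegrE ?expR_ge0 ?(ltW zN0)//.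
by rewrite (le_trans _ (expR_ge1Dx _))// lerDr.
Qed.

(** The exponential term is treated with N chosen so that (n^gamma)^N = n^M. *)
Lemma tail_polynomial (k M : nat) (A kappa c Q : R) : 0 < A -> 0 < kappa -> 0 < c ->
  0 < Q -> Q + 1 <= M%:R ->
  exists2 C : R, 0 < C & forall n, (0 < n)%N ->
    2 * expR (A - c * n%:R `^ threshold_exponent k / 4) +
    4 * Num.sqrt n%:R * (kappa / n%:R ^+ M) / (c * n%:R `^ threshold_exponent k) <= C / n%:R `^ Q.
Proof.
move=> A0 ka0 c0 Q0 QM.
pose N := (4 * k.+1 * M)%N.
have N0 : (0 < N)%N.
  rewrite /N muln_gt0/= lt0n; apply/negP => /eqP M0; move: QM; rewrite M0; lra.
pose C1 := 2 * expR A * (4 * N%:R / c) ^+ N.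
pose C2 := 4 * kappa / c.
exists (C1 + C2).
  rewrite addr_gt0//; last by rewrite divr_gt0// mulr_gt0.
  by rewrite mulr_gt0 ?mulr_gt0 ?expR_gt0// exprn_gt0// divr_gt0// mulr_gt0// ltr0n.
move=> n n0; set b := n%:R `^ threshold_exponent k.
have n1 : 1 <= n%:R :> R by rewrite ler1n.
have n0' : 0 < n%:R :> R by rewrite ltr0n.
have b1 : 1 <= b by exact: powR_ge1 (threshold_exponent_ge0 k).
have b0 : 0 < b by lra.
have nQ0 : 0 < n%:R `^ Q :> R by rewrite powR_gt0.
have QM1 : n%:R `^ Q <= n%:R ^+ M :> R.
  by rewrite -powR_mulrn// ler_powR//; lra.
have QM2 : n%:R `^ Q * n%:R <= n%:R ^+ M :> R.
  rewrite -[X in _ * X]powRr1 ?ler0n// -powRD; last by rewrite (gt_eqF n0') implybT.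
  by rewrite -powR_mulrn// ler_powR.
rewrite [leRHS]mulrDl; apply: lerD.
  have step : expR (- (c * b / 4)) <= (4 * N%:R / c) ^+ N / n%:R `^ Q.
    apply: le_trans (expRN_le_pow N0 _) _; first by rewrite divr_gt0// mulr_gt0.
    have -> : N%:R / (c * b / 4) = (4 * N%:R / c) / b.
      by field; rewrite !gt_eqF.
    rewrite expr_div_n ler_wpM2l//.
      by rewrite exprn_ge0// divr_ge0 ?mulr_ge0// ltW.
    by rewrite [in leLHS]/N exprM powR_threshold_exponent lef_pV2 ?posrE// exprn_gt0.
  rewrite expRD mulrA /C1 -[leRHS]mulrA ler_wpM2l// mulr_ge0//.
have sn : Num.sqrt n%:R <= n%:R :> R.
  by rewrite -powR12_sqrt// -[leRHS]powRr1// ler_powR//; lra.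
rewrite ler_pdivlMr// /C2.
have -> : 4 * Num.sqrt n%:R * (kappa / n%:R ^+ M) / (c * b) * n%:R `^ Q =
  (4 * kappa / c) * ((Num.sqrt n%:R * n%:R `^ Q) / (n%:R ^+ M * b)).
  by field; rewrite !gt_eqF// exprn_gt0.
rewrite -[leRHS]mulr1 ler_wpM2l//; first by rewrite divr_ge0 ?mulr_ge0// ltW.
rewrite ler_pdivrMr ?mulr_gt0 ?exprn_gt0// mul1r.
rewrite -[leLHS]mulr1 ler_pM// ?mulr_ge0 ?sqrtr_ge0 ?powR_ge0//.
by rewrite (le_trans _ QM2)// mulrC ler_wpM2l// powR_ge0.
Qed.

End polynomial_decay.

Section moments.
Context {R : realType} (T : set R) (g : R -> R) (lam : R -> R -> R) (a b : R).
Hypothesis iT : is_interval T.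
Hypothesis mg : measurable_fun T g.
Hypothesis hlam : {in `]a, b[, forall th : R, intensity_function T (lam th)}.
Hypothesis L3 : condition_L3 a b T g lam.
Local Notation leb := (@lebesgue_measure R).

Lemma uniform_moment (q : nat) : (0 < q)%N -> exists2 kappa : R, 0 < kappa &
  {in `]a, b[, forall th : R,
    (\int[leb]_(x in T) (`|g x| ^+ q * lam th x)%:E <= kappa%:E)%E}.
Proof.
move=> q0; have := L3 (q := q%:R); rewrite ltr0n => /(_ q0).
set S := ereal_sup _ => Sfin.
have SE th : th \in `]a, b[ -> (\int[leb]_(x in T) (`|g x| ^+ q * lam th x)%:E <= S)%E.
  move=> thab; apply: ereal_sup_ubound; exists th => //=.
  by apply: eq_integral => x _; rewrite powR_mulrn.
exists (Num.max (fine S) 1); first by rewrite lt_max ltr01 orbT.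
move=> th thab; apply: le_trans (SE th thab) _.
have S0 : (0 <= S)%E.
  apply: le_trans (SE th thab); apply: integral_ge0 => x Tx.
  rewrite lee_fin mulr_ge0//.
  by case: (hlam thab) => + _ _; apply.
by rewrite -[leLHS]fineK ?ge0_fin_numE// lee_fin le_max lexx.
Qed.

(** Where |g| exceeds sqrt n it is at most |g| ^ (2 M + 1) / n ^ M. *)
Lemma uniform_truncated_moment (M : nat) : exists2 kappa : R, 0 < kappa &
  forall n, (0 < n)%N -> {in `]a, b[, forall th : R,
    (\int[leb]_(x in T) ((if Num.sqrt n%:R < `|g x| then `|g x| else 0) * lam th x)%:E
      < (kappa / n%:R ^+ M)%:E)%E}.
Proof.
have [kappa ka0 H] := @uniform_moment (2 * M).+1 isT.
exists (kappa + 1); first lra.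
move=> n n0 th thab.
have l0 x : T x -> 0 <= lam th x by case: (hlam thab) => + _ _; exact.
have ml : measurable_fun T (lam th) by case: (hlam thab).
have mT : measurable T by exact: is_interval_measurable.
have nM0 : 0 < n%:R ^+ M :> R by rewrite exprn_gt0// ltr0n.
have mgn : measurable_fun T (fun x => `|g x|) by exact: measurableT_comp.
have mphi : measurable_fun setT
    (fun z : R => if Num.sqrt n%:R < `|z| then `|z| else 0).
  apply: measurable_fun_ifT => //.
  by apply: measurable_fun_ltr => //; exact: normr_measurable.
apply: (@le_lt_trans _ _ (\int[leb]_(x in T) ((n%:R ^+ M)^-1%:E *
    (`|g x| ^+ (2 * M).+1 * lam th x)%:E))%E).
  apply: ge0_le_integral => //.
  - by move=> x Tx; rewrite lee_fin mulr_ge0 ?l0//; case: ifP.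
  - apply/measurable_EFinP; apply: measurable_funM => //.
    exact: (measurableT_comp mphi mg).
  - apply: measurable_funeM; apply/measurable_EFinP; apply: measurable_funM => //.
    exact: measurable_funX.
  - move=> x Tx; rewrite -EFinM lee_fin mulrA ler_wpM2r ?l0//.
    case: ifPn => [ng|_]; last by rewrite mulr_ge0 ?exprn_ge0// invr_ge0 ltW.
    rewrite exprSr mulrA -[leLHS]mul1r ler_wpM2r// mulrC ler_pdivlMr// mul1r.
    rewrite exprM lerXn2r ?nnegrE ?sqr_ge0//.
    by rewrite -[leLHS]sqr_sqrtr// lerXn2r ?nnegrE ?sqrtr_ge0// ltW.
rewrite ge0_integralZl//; last 2 first.
- apply/measurable_EFinP; apply: measurable_funM => //; exact: measurable_funX.
- by move=> x Tx; rewrite lee_fin mulr_ge0 ?l0.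
apply: (@le_lt_trans _ _ ((n%:R ^+ M)^-1%:E * kappa%:E)%E).
  by rewrite lee_wpmul2l ?lee_fin ?invr_ge0 ?H// ltW.
by rewrite -EFinM lte_fin mulrC ltr_pM2r ?invr_gt0// ltrDl.
Qed.

End moments.

(** * The expansion of the method of moments estimator *)

Lemma ex_mfun {d} {Omega : measurableType d} {R : realType} (f : Omega -> R) :
  measurable_fun setT f -> exists F : {mfun Omega >-> R}, F = f :> (Omega -> R).
Proof.
move=> mf.
by exists (HB.pack_for {mfun Omega >-> R} f (isMeasurableFun.Build _ _ _ _ f mf)).
Qed.

(** Over an empty T the moment would be constant. *)
Lemma moment_domain {R : realType} (a b : R) (T : set R) (g : R -> R)
    (lam : R -> R -> R) : a < b -> condition_L2 a b (moment T g lam) -> exists t0, T t0.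
Proof.
move=> ab L2; have [c c0 cm] := L2_inf L2.
have [T0|/set0P//] := eqVneq T set0.
have mab : (a + b) / 2 \in `]a, b[ by rewrite in_itv/=; apply/andP; split; lra.
have := cm _ mab; rewrite (_ : moment T g lam = cst 0); last first.
  by apply/funext => th; rewrite /moment T0 Rintegral_set0.
by rewrite derive1_cst normr0 leNgt c0.
Qed.

Theorem theorem1 (R : realType) (alpha beta : R) (halphabeta : alpha < beta)
    (T : set R) (hT : is_interval T)
    (lam : R -> R -> R)
    (hlam : {in `]alpha, beta[, forall th : R, intensity_function T (lam th)})
    (g : R -> R) (hg : measurable_fun T g)
    (d : nat -> measure_display) (Omega : forall n, measurableType (d n))
    (P : forall n, R -> probability (Omega n) R)
    (X : forall n, 'I_n -> R -> {mfun Omega n >-> R})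
    (hX : forall n, (0 < n)%N -> {in `]alpha, beta[, forall th : R,
       poisson_sample (P n th) T (lam th) (fun j t => X n j t)})
    (k : nat) (hk : (1 <= k)%N) :
  let m := moment T g lam in
  let mbar n := empirical_moment T g (fun j t => X n j t) in
  let eta n th w := Num.sqrt n%:R * (mbar n w - m th) in
  condition_L1 alpha beta k m ->
  condition_L2 alpha beta m ->
  condition_L3 alpha beta T g lam ->
  exists (r phi : forall n, R -> {mfun Omega n >-> R})
         (B : forall n, R -> set (Omega n)),
    (forall n, (1 <= n)%N -> {in `]alpha, beta[, forall th0 : R,
       measurable (B n th0) /\
       forall w : Omega n,
         [/\ `|r n th0 w| <= 1,
             phi n th0 w \in `[alpha - th0, beta - th0] &
             mme alpha beta m (mbar n w) =
             th0 +
             (\sum_(1 <= l < k.+1) psi alpha beta m l th0 * eta n th0 w ^+ l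
                                   * n%:R `^ (- (l%:R / 2))
              + r n th0 w * n%:R `^ (- (k%:R / 2) - 4^-1))
             * \1_(B n th0) w
             + phi n th0 w * \1_(~` B n th0) w]}) /\
    (forall (Q : R) (K : set R), 0 < Q -> compact K ->
       K `<=` `]alpha, beta[%classic ->
       exists C : R, 0 < C /\
         forall n, (1 <= n)%N ->
           (ereal_sup [set P n th0 (~` B n th0) | th0 in K]
              <= (C / n%:R `^ Q)%:E)%E).
Proof.
move=> m mbar eta L1 L2 L3.
have [t0 Tt0] := moment_domain halphabeta L2.
have [mme_in mmme mIm [C0 C00 taylor] Kball] := mme_expansion halphabeta L1 L2.
have [th1 th1ab] : exists th1 : R, th1 \in `]alpha, beta[.
  by exists ((alpha + beta) / 2); rewrite in_itv/=; apply/andP; split; lra.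
have mX n (j : 'I_n) t : measurable_fun setT (X n j t) by exact: measurable_funPT.
have mmbar n : (0 < n)%N -> measurable_fun setT (mbar n).
  move=> n0; apply: (measurable_empirical_moment hT (hlam th1 th1ab) hg Tt0).
    by move=> j t; exact: mX.
  exact: (hX n n0 th1 th1ab).
(* c0 <= 1 and C0 c0 <= 1 give C0 c0 ^ (k + 1) <= 1 *)
pose c0 := Num.min 1 C0^-1.
have c00 : 0 < c0 by rewrite lt_min ltr01 invr_gt0.
pose B n th0 := [set w | (m @` `]alpha, beta[) (mbar n w) /\
  Num.sqrt n%:R * `|mbar n w - m th0| <= c0 * n%:R `^ threshold_exponent k].
pose rem n th0 w := (mme alpha beta m (mbar n w) -
  (th0 + \sum_(1 <= l < k.+1) psi alpha beta m l th0 * (mbar n w - m th0) ^+ l)) *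
  n%:R `^ (k%:R / 2 + 4^-1) * \1_(B n th0) w.
have mB n th0 : (0 < n)%N -> measurable (B n th0).
  move=> n0; apply: measurableI.
    by rewrite -[X in measurable X]setTI; exact: mmbar.
  rewrite -[X in measurable X]setTI; apply: measurable_fun_le => //.
  apply: measurable_funM => //; apply: measurableT_comp => //.
  by apply: measurable_funB => //; exact: mmbar.
have bound n th0 w : (0 < n)%N -> th0 \in `]alpha, beta[ -> `|rem n th0 w| <= 1.
  move=> n0 th0ab; rewrite /rem indicE.
  have [|_] := boolP (w \in B n th0); last by rewrite mulr0 normr0.
  rewrite inE => -[wI wD]; rewrite mulr1 normrM.
  have n0' : 0 < n%:R :> R by rewrite ltr0n.
  have s0 : 0 < Num.sqrt n%:R :> R by rewrite sqrtr_gt0.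
  rewrite [X in _ * X]ger0_norm ?powR_ge0//.
  rewrite -ler_pdivlMr ?powR_gt0// mul1r.
  apply: le_trans (taylor _ _ th0ab wI) _.
  rewrite -ler_pdivlMl//.
  have distB : `|mbar n w - m th0| <= c0 * (n%:R `^ threshold_exponent k / Num.sqrt n%:R).
    by rewrite mulrA ler_pdivlMr// mulrC.
  apply: (@le_trans _ _ ((c0 * (n%:R `^ threshold_exponent k / Num.sqrt n%:R)) ^+ k.+1)).
    by rewrite lerXn2r// nnegrE// (le_trans _ distB).
  have q0 : 0 <= n%:R `^ threshold_exponent k / Num.sqrt n%:R :> R.
    by rewrite divr_ge0 ?powR_ge0// ltW.
  rewrite exprMn; apply: ler_pM; first by rewrite exprn_ge0// ltW.
  - exact: exprn_ge0.
  - have c01 : c0 <= 1 by rewrite ge_min lexx.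
    have c0C : c0 <= C0^-1 by rewrite ge_min lexx orbT.
    apply: le_trans c0C; rewrite exprS -[leRHS]mulr1 ler_wpM2l ?(ltW c00)//.
    by rewrite exprn_ile1 ?(ltW c00).
  - rewrite -powR12_sqrt// -!powRN -powRD ?(gt_eqF n0') ?implybT//.
  rewrite -powR_mulrn ?powR_ge0// -powRrM.
  rewrite (_ : (threshold_exponent k - 2^-1) * k.+1%:R = - (k%:R / 2 + 4^-1))//.
  have k1 : 0 < k%:R + 1 :> R by rewrite natr1 ltr0n.
  rewrite (_ : threshold_exponent k = (4 * (k%:R + 1))^-1); last by rewrite natr1 /threshold_exponent natrM.
  rewrite (_ : k.+1%:R = k%:R + 1 :> R); last by rewrite natr1.
  by field; rewrite gt_eqF.
(* for n = 0 the moment need not be measurable, and r and phi are arbitrary *)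
have exrp n th0 : exists rp : {mfun Omega n >-> R} * {mfun Omega n >-> R},
    (0 < n)%N -> (rp.1 = rem n th0 :> (Omega n -> R)) /\
      (rp.2 = (fun w => mme alpha beta m (mbar n w) - th0) :> (Omega n -> R)).
  have [n0|] := posnP n.
    have [z _] := @ex_mfun _ (Omega n) R (cst 0) (measurable_cst _).
    by exists (z, z).
  move=> n0.
  have mM : measurable_fun setT (fun w => mme alpha beta m (mbar n w)).
    exact: (measurableT_comp mmme (mmbar n n0)).
  have [|r rE] := @ex_mfun _ (Omega n) R (rem n th0).
    apply: measurable_funM; last exact: measurable_indic (mB n th0 n0).
    apply: measurable_funM => //; apply: measurable_funB => //.
    apply: measurable_funD => //; apply: measurable_sum => l.
    apply: measurable_funM => //; apply: measurable_funX.
    by apply: measurable_funB => //; exact: mmbar.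
  have [|phi phiE] := @ex_mfun _ (Omega n) R (fun w => mme alpha beta m (mbar n w) - th0).
    exact: measurable_funB.
  by exists (r, phi).
pose rp n th0 := sval (cid (exrp n th0)).
have rpE n th0 : (0 < n)%N -> ((rp n th0).1 = rem n th0 :> (Omega n -> R)) /\
    ((rp n th0).2 = (fun w => mme alpha beta m (mbar n w) - th0) :> (Omega n -> R)).
  exact: (svalP (cid (exrp n th0))).
exists (fun n th0 => (rp n th0).1), (fun n th0 => (rp n th0).2), B; split.
  move=> n n0 th0 th0ab; split; first exact: mB.
  have [rE phiE] := rpE n th0 n0.
  have n0' : 0 < n%:R :> R by rewrite ltr0n.
  move=> w; rewrite rE phiE; split.
  - exact: bound.
  - by have := mme_in (mbar n w); rewrite !in_itv/= => /andP[h1 h2]; rewrite !lerD2r h1.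
  - rewrite (_ : \sum_(1 <= l < k.+1) _ =
      \sum_(1 <= l < k.+1) psi alpha beta m l th0 * (mbar n w - m th0) ^+ l); last first.
      apply: eq_bigr => l _; rewrite -mulrA; congr (_ * _).
      have sl : Num.sqrt n%:R ^+ l = n%:R `^ (l%:R / 2) :> R.
        by rewrite -powR12_sqrt// -powR_mulrn ?powR_ge0// -powRrM mulrC.
      rewrite /eta exprMn sl mulrAC -powRD ?(gt_eqF n0') ?implybT//.
      by rewrite subrr powRr0 mul1r.
    rewrite /rem !indicE in_setC; case: (w \in B n th0) => /=; last first.
      by rewrite !mulr0 mulr1 addr0 addrC subrK.
    rewrite !mulr1 mulr0 addr0 -mulrA.
    rewrite -powRD ?(gt_eqF n0') ?implybT//.
    rewrite (_ : k%:R / 2 + 4^-1 + (- (k%:R / 2) - 4^-1) = 0); last by ring.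
    by rewrite powRr0 mulr1; ring.
move=> Q K Q0 cK Kab.
have [h h0 Kh] := Kball K cK Kab.
have [k2 k20 int2] := uniform_moment hlam L3 (q := 2) isT.
have [k1 k10 int1] := uniform_moment hlam L3 (q := 1) isT.
pose M := (Num.truncn (Q + 1)).+1.
have QM : Q + 1 <= M%:R by exact/ltW/truncnS_gt.
have [kM kM0 intM] := uniform_truncated_moment hT hg hlam L3 M.
pose c := Num.min c0 h.
have c_gt0 : 0 < c by rewrite lt_min c00.
have [|C C_gt0 CP] := @tail_polynomial R k M ((k2 + 1) / 2) kM c Q _ kM0 c_gt0 Q0 QM.
  by rewrite divr_gt0// addr_gt0.
exists C; split => // n n0.
apply: ge_ereal_sup => _ [th Kth <-].
have thab : th \in `]alpha, beta[ by have := Kab th Kth.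
have n0' : 0 < n%:R :> R by rewrite ltr0n.
have b0 : 0 < n%:R `^ threshold_exponent k :> R by rewrite powR_gt0.
have y0 : 0 < c * n%:R `^ threshold_exponent k by rewrite mulr_gt0.
have i1 : (\int[lebesgue_measure]_(x in T) (`|g x| * lam th x)%:E < +oo)%E.
  apply: (le_lt_trans _ (ltry k1)); apply: le_trans (int1 th thab).
  by rewrite le_eqVlt; apply/orP; left; apply/eqP; apply: eq_integral => x _; rewrite expr1.
have i2 : (\int[lebesgue_measure]_(x in T) (g x ^+ 2 * lam th x)%:E <= k2%:E)%E.
  apply: le_trans (int2 th thab).
  rewrite le_eqVlt; apply/orP; left; apply/eqP; apply: eq_integral => x _.
  by rewrite real_normK ?num_real.
have tail := empirical_moment_tail hT (hlam th thab) hg Tt0 n0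
  (fun j t => mX n j t) (hX n n0 th thab) i1 i2 (intM n n0 th thab) y0.
apply: (@le_trans _ _ (P n th [set w | c * n%:R `^ threshold_exponent k <=
    Num.sqrt n%:R * `|mbar n w - m th|])).
  apply: le_measure; rewrite ?inE.
  - by apply: measurableC; exact: mB.
  - rewrite -[X in measurable X]setTI; apply: measurable_fun_le => //.
    apply: measurable_funM => //; apply: measurableT_comp => //.
    by apply: measurable_funB => //; exact: mmbar.
  - move=> w /= /not_andP[nI|/negP].
      have Dh : h < `|mbar n w - m th|.
        by rewrite ltNge; apply/negP => /(Kh th (mbar n w) Kth).
      rewrite mulrC ler_pM ?powR_ge0 ?(ltW c_gt0)//; first exact: sqrt_ge_powR_threshold.
      by rewrite (le_trans _ (ltW Dh))// ge_min lexx orbT.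
    rewrite -ltNge => /ltW; apply: le_trans.
    by rewrite ler_wpM2r ?powR_ge0// ge_min lexx.
by apply: le_trans tail _; rewrite lee_fin; exact: CP.
Qed.
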